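(* Let $W\subset\mathbb{R}^3$ be a nonempty open set, let $\varepsilon>0$, $T>0$, and let $e\colon[0,T]\to[0,\infty)$ be a nonincreasing function. Then there exist $\nu_0>0$ and a vector field $u$ on $\mathbb{R}^3\times[0,\infty)$ such that $u$ is a weak solution of the Navier--Stokes inequality with viscosity $\nu$ for every $\nu\in[0,\nu_0]$ (the same $u$ for all such $\nu$), $\operatorname{supp} u(t)\subset W$ for all $t\in[0,T]$, and $$\bigl|\,\|u(t)\|-e(t)\,\bigr|\le\varepsilon\qquad\text{for all }t\in[0,T].$$
   Context: $\|\cdot\|$ denotes the $L^2(\mathbb{R}^3)$ norm, and $u(t)=u(\cdot,t)$. Pressure corresponding to $u$: at each time, $p:=\sum_{i,j=1}^3\partial_{ij}\Psi*(u_iu_j)$, where $\Psi(x)=(4\pi|x|)^{-1}$ and $*$ is convolution on $\mathbb{R}^3$ (so that $-\Delta p=\sum_{i,j}\partial_i\partial_j(u_iu_j)$). Weak solution of the Navier--Stokes inequality (NSI) with viscosity $\nu$: a divergence-free vector field $u$ on $\mathbb{R}^3\times(0,\infty)$ with values in $\mathbb{R}^3$ satisfying $\sup_{t>0}\|u(t)\|<\infty$, $\nabla u\in L^2(\mathbb{R}^3\times(0,\infty))$ and the local energy inequality $$2\nu\int_0^\infty\!\!\int_{\mathbb{R}^3}|\nabla u|^2\varphi\le\int_0^\infty\!\!\int_{\mathbb{R}^3}\Bigl(|u|^2(\partial_t\varphi+\nu\Delta\varphi)+(|u|^2+2p)(u\cdot\nabla)\varphi\Bigr)$$ for all non-negative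 $\varphi\in C_0^\infty(\mathbb{R}^3\times(0,\infty))$, where $p$ is the pressure corresponding to $u$. For $\nu=0$ the same definition is used with $\nu=0$ in this inequality. (It is the weak form of $u\cdot(\partial_tu-\nu\Delta u+(u\cdot\nabla)u+\nabla p)\le0$.) *)

(* Defs.v *)
From HB Require Import structures.
From mathcomp Require Import all_boot all_order all_algebra.
From mathcomp Require Import all_classical all_reals all_analysis.

Set Implicit Arguments.
Unset Strict Implicit.
Unset Printing Implicit Defensive.
Import Order.TTheory GRing.Theory Num.Theory.
Import numFieldNormedType.Exports.
Local Open Scope classical_set_scope.
Local Open Scope ring_scope.

(* R^3 is the triple product rather than 'rV[R]_3 because the product carries
   both the normed-module structure and the product measure. The norm of the
   library on it is the sup norm; only its topology is used here. *)
Notation R3 R := (R * R * R)%type.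

Section NavierStokesInequality.
Context {R : realType}.
Implicit Types (u : R -> R3 R -> R3 R) (p : R -> R3 R -> R).

Local Notation leb := (@lebesgue_measure R).

Definition leb3 :
    set (measurableTypeR R * measurableTypeR R * measurableTypeR R)
    -> \bar R :=
  (leb \x leb \x leb)%E.

HB.instance Definition _ := Measure.on leb3.

Definition coord3 (i : 'I_3) (x : R3 R) : R :=
  if i == 0 :> nat then x.1.1 else if i == 1 :> nat then x.1.2 else x.2.

Definition basis3 (i : 'I_3) : R3 R :=
  ((i == 0 :> nat)%:R, (i == 1 :> nat)%:R, (i == 2 :> nat)%:R).

Definition enorm (x : R3 R) : R := Num.sqrt (\sum_i coord3 i x ^+ 2).

Definition supp (X : topologicalType) (Y : zmodType) (f : X -> Y) : set X :=
  closure [set x | f x != 0].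

Section Test.
Context {V : normedModType R}.

Fixpoint iterD (vs : seq V) (f : V -> R) : V -> R :=
  if vs is v :: vs' then 'D_v (iterD vs' f) else f.

(* On a finite-dimensional V this is C^oo: all iterated directional
   derivatives exist and are continuous. *)
Definition smooth (f : V -> R) : Prop :=
  forall vs : seq V,
    continuous (iterD vs f) /\ forall x v, derivable (iterD vs f) x v.

(* C_0^oo(U), functions being extended by 0 outside the open set U. *)
Definition test_function (U : set V) (f : V -> R) : Prop :=
  [/\ smooth f, compact (supp f) & supp f `<=` U].

End Test.

Definition partial (i : 'I_3) (psi : R3 R -> R) : R3 R -> R :=
  'D_(basis3 i) psi.

Definition dt (phi : R * R3 R -> R) : R * R3 R -> R := 'D_(1, 0) phi.

Definition dx (i : 'I_3) (phi : R * R3 R -> R) : R * R3 R -> R :=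
  'D_(0, basis3 i) phi.

Definition laplacian (phi : R * R3 R -> R) (z : R * R3 R) : R :=
  \sum_i dx i (dx i phi) z.

Definition positive_times : set (R * R3 R) := [set z | 0 < z.1].

Definition L2norm (v : R3 R -> R3 R) : \bar R :=
  ('N[leb3]_2%:E[ (fun x => (enorm (v x))%:E) ])%E.

Definition divergence_free (v : R3 R -> R3 R) : Prop :=
  forall psi : R3 R -> R, test_function setT psi ->
    \int[leb3]_x (\sum_i coord3 i (v x) * partial i psi x) = 0.

(* g i j is the weak derivative d_j u_i on R^3 x (0,oo). *)
Definition weak_gradient u (g : 'I_3 -> 'I_3 -> R -> R3 R -> R) : Prop :=
  forall i j (phi : R * R3 R -> R), test_function positive_times phi ->
    \int[leb]_(t in `]0, +oo[) \int[leb3]_x (coord3 i (u t x) * dx j phi (t, x))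
    = - \int[leb]_(t in `]0, +oo[) \int[leb3]_x (g i j t x * phi (t, x)).

Definition Psi (x : R3 R) : R := (4 * pi * enorm x)^-1.

Definition convolution (f h : R3 R -> R) (x : R3 R) : R :=
  \int[leb3]_y (f (x - y) * h y).

(* The distribution \sum_ij (d_ij Psi) * (v_i v_j), applied to psi. *)
Definition pressure_distribution (v : R3 R -> R3 R) (psi : R3 R -> R) : R :=
  \sum_i \sum_j
    \int[leb3]_x (convolution Psi (fun y => coord3 i (v y) * coord3 j (v y)) x
                  * partial i (partial j psi) x).

Definition locally_integrable3 (f : R3 R -> R) : Prop :=
  measurable_fun setT f /\
  forall K : set (R3 R), compact K -> leb3.-integrable K (EFin \o f).

(* For v in L^2 the pressure is in general only a distribution. For u as in
   [weak_NSI], u(t) is in H^1 for almost every t, and then the pressure is a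
   function, unique up to null sets. *)
Definition is_pressure u p : Prop :=
  measurable_fun positive_times (fun z : R * R3 R => p z.1 z.2) /\
  {ae leb, forall t, 0 < t ->
    locally_integrable3 (p t) /\
    forall psi : R3 R -> R, test_function setT psi ->
      \int[leb3]_x (p t x * psi x) = pressure_distribution (u t) psi}.

Definition local_energy_inequality (nu : R) u p
    (g : 'I_3 -> 'I_3 -> R -> R3 R -> R) : Prop :=
  forall phi : R * R3 R -> R,
    test_function positive_times phi -> (forall z, 0 <= phi z) ->
  ((2 * nu)%:E * (\int[leb]_(t in `]0%R, +oo[) \int[leb3]_x
      ((\sum_i \sum_j g i j t x ^+ 2) * phi (t, x))%:E)
   <= \int[leb]_(t in `]0%R, +oo[) \int[leb3]_x
      (enorm (u t x) ^+ 2 * (dt phi (t, x) + nu * laplacian phi (t, x))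
       + (enorm (u t x) ^+ 2 + 2 * p t x)
         * \sum_i coord3 i (u t x) * dx i phi (t, x))%:E)%E.

(* The weak gradient g and the pressure p are determined by u up to null
   sets. *)
Definition weak_NSI (nu : R) u : Prop :=
  [/\ measurable_fun positive_times (fun z : R * R3 R => u z.1 z.2),
      forall t, 0 < t -> divergence_free (u t),
      (ereal_sup [set L2norm (u t) | t in `]0%R, +oo[] < +oo)%E
    & exists (g : 'I_3 -> 'I_3 -> R -> R3 R -> R) (p : R -> R3 R -> R),
      [/\ forall i j,
            measurable_fun positive_times (fun z : R * R3 R => g i j z.1 z.2),
          (\int[leb]_(t in `]0%R, +oo[) \int[leb3]_x
             (\sum_i \sum_j g i j t x ^+ 2)%:E < +oo)%E,
          weak_gradient u g,
          is_pressure u p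
        & local_energy_inequality nu u p g]].

End NavierStokesInequality.

(* Main.v *)
From HB Require Import structures.
Require Import Defs.
From mathcomp Require Import all_boot all_order all_algebra.
From mathcomp Require Import all_classical all_reals all_analysis.
From mathcomp Require Import measurable_realfun.
From mathcomp Require Import ring lra.

Set Implicit Arguments.
Unset Strict Implicit.
Unset Printing Implicit Defensive.
Import Order.TTheory GRing.Theory Num.Theory.
Import numFieldNormedType.Exports.
Local Open Scope classical_set_scope.
Local Open Scope ring_scope.

(** The solution is a decaying swirl.  Let a be a point of W, let
    d = rho^2 - |x - a|^2 for a small rho, and let v = (max 0 d)^2 (-y, x, 0),
    where (x, y, z) are coordinates centred at a.  This field is supported in
    the closed ball of radius rho about a, it is divergence free, and it points
    along the circles around the vertical axis through a.  Both |v|^2 and the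
    pressure q of v are invariant under the rotations about that axis, so
    (v . grad) (|v|^2 + 2 q) = 0 ([swirl_transport], [pressure_transport]).
    For u(t) = eta(t) v the flux term of the local energy inequality therefore
    vanishes whatever eta is, and what remains, formally, is the pointwise
    inequality (eta^2)' |v|^2 <= nu eta^2 (Delta |v|^2 - 2 |grad v|^2).

    The right-hand bracket is 2 v . Delta v.  It could be negative, but it is
    at least - 2 C |v|^2 with C = 25 / rho^2 ([swirl_dissipation]): near the
    sphere d = 0, where |v|^2 degenerates, the second derivative of d^2 is
    positive and wins.  Hence eta(t) = exp(- lam t) w(t), with w nonnegative and
    nonincreasing, is admissible as soon as nu C <= lam.  Taking w to be e
    divided by the norm of v, extended by 0 after T, gives
    ||u(t)|| = exp(- lam t) e(t), which is within eps of e(t) on [0, T] once lam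
    is small, and nu0 = lam / C.

    Two points need analysis.

    The function e may jump, so (eta^2)' is only a measure.  But w^2 is a
    superposition of indicator functions of half-lines, and on a half-line the
    fundamental theorem of calculus leaves one boundary term, of the right sign
    ([nonincreasing_weight_ge0]).

    The pressure is Psi * div div (v (x) v), which is a bounded function since
    Psi is locally integrable ([Psi_cube_bound]) and div div (v (x) v) is
    continuous with bounded support.  Its two properties, that it represents the
    distribution sum_ij (d_ij Psi) * (v_i v_j) and that it is rotation
    invariant, are stated through the bilinear form
    newton_form A B = int int Psi (x - y) A x B y: derivatives along a
    coordinate axis, and derivatives along the rotation field, are skew for it
    ([newton_form_partial], [newton_form_rotational]).  Both are obtained for a
    C^1 regularization of Psi by integrating by parts and then passing to the
    limit, so that no derivative of Psi is ever needed. *)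

(** * Continuous functions of bounded support *)

Section CompactBalls.
Context {R : realType}.
Implicit Types V : normedModType R.

(** The Heine-Borel property, in a form that a product inherits from its factors. *)
Definition proper_norm V := forall a : R, compact [set x : V | `|x| <= a].

Lemma proper_norm_real : proper_norm R.
Proof.
move=> a; rewrite (_ : [set _ | _] = `[- a, a]%classic); first exact: segment_compact.
by apply/seteqP; split => x /=; rewrite in_itv/= ler_norml.
Qed.

Lemma proper_norm_prod V1 V2 : proper_norm V1 -> proper_norm V2 -> proper_norm (V1 * V2)%type.
Proof.
move=> c1 c2 a.
rewrite (_ : [set _ | _] = [set x : V1 | `|x| <= a] `*` [set x : V2 | `|x| <= a]).
  exact: compact_setX.
by apply/seteqP; split => -[x y] /=; rewrite prod_normE/= ge_max => /andP.
Qed.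

(** Bounded support is phrased by the norm rather than by compactness: only a bound on the
    size of the support enters the integrability arguments. *)
Definition C0c V (f : V -> R) := continuous f /\ exists a : R, forall x : V, a < `|x| -> f x = 0.

Lemma C0c_bounded V (f : V -> R) : proper_norm V -> C0c f ->
  exists M : R, forall x, `|f x| <= M.
Proof.
move=> cV [cf [a fa]].
have : compact (f @` [set x | `|x| <= a]).
  by apply: continuous_compact => //; exact: continuous_subspaceT.
move=> /compact_bounded [M [_ /(_ (`|M| + 1))]].
rewrite (le_lt_trans (ler_norm M))// ?ltrDl// => /(_ erefl) HM.
exists (`|M| + 1) => x; case: (leP `|x| a) => xa.
  by apply: HM; exists x.
by rewrite fa// normr0 addr_ge0.
Qed.
End CompactBalls.

(** * Borel measurability of continuous functions on products *)

Section CountableBase.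
Context {R : realType}.

(** Open sets of R^3 have to be measurable for the product sigma-algebra, which is generated
    by boxes and not by open sets.  A countable base of measurable sets gives this and, unlike
    the measurability of open sets itself, is inherited by products. *)
Definition measurable_base d (T : measurableType d) (O : set (set T)) :=
  exists2 B : nat -> set T, (forall n, measurable (B n)) &
    forall (U : set T) x, O U -> U x -> exists n, B n x /\ B n `<=` U.

Lemma measurable_base_open d (T : measurableType d) (O : set (set T)) :
  measurable_base O -> O `<=` measurable.
Proof.
move=> [B mB BO] U OU.
rewrite (_ : U = \bigcup_(n in [set n | B n `<=` U]) B n); first exact: bigcup_measurable.
apply/seteqP; split => x; last by move=> [n nU /nU].
by move=> Ux; have [n [nx nU]] := BO _ _ OU Ux; exists n.
Qed.

Lemma measurable_base_prod d1 d2 (T1 : measurableType d1) (T2 : measurableType d2)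
    (O1 : set (set T1)) (O2 : set (set T2)) (O : set (set (T1 * T2))) :
  (forall U x, O U -> U x -> exists V W,
    [/\ O1 V, O2 W, V x.1, W x.2 & V `*` W `<=` U]) ->
  measurable_base O1 -> measurable_base O2 -> measurable_base O.
Proof.
move=> OO [B1 mB1 BO1] [B2 mB2 BO2].
exists (fun n => if unpickle n is Some (n1, n2) then B1 n1 `*` B2 n2 else set0).
  by move=> n; case: unpickle => // -[n1 n2]; exact: measurableX.
move=> U x OU Ux; have [V [W [OV OW Vx Wx VWU]]] := OO _ _ OU Ux.
have [n1 [? V1]] := BO1 _ _ OV Vx; have [n2 [? W2]] := BO2 _ _ OW Wx.
exists (pickle (n1, n2)); rewrite pickleK; split => // -[y1 y2] [/= /V1 ? /W2 ?].
exact: VWU.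
Qed.

Lemma measurable_base_real : @measurable_base _ (measurableTypeR R) (@open R).
Proof.
exists (fun n => if unpickle n is Some (p, q) then `](ratr p : R), (ratr q : R)[%classic else set0).
  by move=> n; case: unpickle => // -[p q]; exact: measurable_itv.
move=> U x oU Ux.
have /nbhs_ballP[e /= e0 xeU] : nbhs x U by exact: open_nbhs_nbhs.
have [p] := @rat_in_itvoo R (x - e) x ltac:(by rewrite ltrBlDr ltrDl).
have [q] := @rat_in_itvoo R x (x + e) ltac:(by rewrite ltrDl).
rewrite !in_itv/= => /andP[q1 q2] /andP[p1 p2].
exists (pickle (p, q)); rewrite pickleK; split => /=; first by rewrite in_itv/= p2 q1.
move=> y /=; rewrite in_itv/= => /andP[y1 y2]; apply: xeU.
by rewrite /ball/= distrC ltr_distl (lt_trans p1)//= (lt_trans y2).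
Qed.

Lemma open_prod_box (X Y : topologicalType) (U : set (X * Y)) x : open U -> U x ->
  exists V W, [/\ open V, open W, V x.1, W x.2 & V `*` W `<=` U].
Proof.
move=> oU Ux; have [[P Q] /= [nP nQ] PQU] : nbhs x U by exact: open_nbhs_nbhs.
exists (interior P), (interior Q); split; try exact: open_interior.
- exact: nP.
- exact: nQ.
- by move=> z [/= z1 z2]; apply: PQU; split; exact: interior_subset.
Qed.

Lemma measurable_base_R3 :
  @measurable_base _ (measurableTypeR R * measurableTypeR R * measurableTypeR R)%type (@open (R3 R)).
Proof.
apply: (measurable_base_prod (@open_prod_box (R * R)%type R)) measurable_base_real.
exact: (measurable_base_prod (@open_prod_box R R) measurable_base_real measurable_base_real).
Qed.

Lemma measurable_base_RR3 :
  @measurable_base _ (measurableTypeR R * (measurableTypeR R * measurableTypeR R * measurableTypeR R))%type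
   (@open (R * R3 R)%type).
Proof.
exact: (measurable_base_prod (@open_prod_box R (R3 R)) measurable_base_real measurable_base_R3).
Qed.

Lemma measurable_base_R3R3 :
  @measurable_base _ ((measurableTypeR R * measurableTypeR R * measurableTypeR R) * (measurableTypeR R * measurableTypeR R * measurableTypeR R))%type
   (@open (R3 R * R3 R)%type).
Proof.
exact: (measurable_base_prod (@open_prod_box (R3 R) (R3 R)) measurable_base_R3 measurable_base_R3).
Qed.

Lemma measurable_fun_base d (T : measurableType d) (O : set (set T)) (f : T -> R) :
  measurable_base O -> (forall U : set R, open U -> O (f @^-1` U)) ->
  measurable_fun setT f.
Proof.
move=> /measurable_base_open bO Of.
apply: (measurability _ (RGenOpens.measurableE R)) => _ [_ [a [b ->]] <-].
by rewrite setTI; apply: bO; apply: Of; exact: interval_open.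
Qed.

Lemma continuous_measurable_R3 (f : R3 R -> R) : continuous f ->
  measurable_fun setT f.
Proof. by move=> /continuousP cf; exact: (measurable_fun_base measurable_base_R3 cf). Qed.

Lemma continuous_measurable_RR3 (f : R * R3 R -> R) : continuous f ->
  measurable_fun setT f.
Proof. by move=> /continuousP cf; exact: (measurable_fun_base measurable_base_RR3 cf). Qed.

Lemma continuous_measurable_R3R3 (f : R3 R * R3 R -> R) : continuous f ->
  measurable_fun setT f.
Proof. by move=> /continuousP cf; exact: (measurable_fun_base measurable_base_R3R3 cf). Qed.

End CountableBase.

(** * Integrability of continuous functions of bounded support *)

Section BoundedIntegrable.
Context d (T : measurableType d) {R : realType} (mu : {measure set T -> \bar R}).

Lemma bounded_support_integrable (K : set T) (f : T -> R) (M : R) :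
  measurable K -> (mu K < +oo)%E -> measurable_fun setT f ->
  (forall x, `|f x| <= M) -> (forall x, ~ K x -> f x = 0) ->
  mu.-integrable setT (EFin \o f).
Proof.
move=> mK K_fin mf fM f0.
have -> : EFin \o f = (EFin \o f) \_ K.
  by apply/funext => x; rewrite patchE; case: ifPn => // /negP; rewrite inE => /f0 /= ->.
apply: (proj1 (integrable_mkcond _ mK)); apply: measurable_bounded_integrable => //.
  exact: measurable_funS mf.
exists M; split; first exact: num_real.
by move=> N MN x _; exact: le_trans (fM x) (ltW MN).
Qed.
End BoundedIntegrable.

Section Cubes.
Context {R : realType}.
Local Notation leb := (@lebesgue_measure R).

Definition cube (V : normedModType R) (a : R) : set V := [set x | `|x| <= a].
Arguments cube : clear implicits.

Lemma cube_prod (V1 V2 : normedModType R) a :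
  cube (V1 * V2)%type a = cube V1 a `*` cube V2 a.
Proof.
by apply/seteqP; split => -[x y] /=; rewrite /cube/= prod_normE/= ge_max => /andP.
Qed.

Lemma cube_real a : cube R a = `[- a, a]%classic.
Proof. by apply/seteqP; split => x; rewrite /cube/= in_itv/= ler_norml. Qed.

Lemma measurable_cube1 a : measurable (cube R a).
Proof. by rewrite cube_real; exact: measurable_itv. Qed.

Lemma cube1_fin a : (leb (cube R a) < +oo)%E.
Proof. by rewrite cube_real lebesgue_measure_itv/=; case: ifP => _; rewrite -?EFinB ltry. Qed.

(** [leb3] unfolds to the product of this measure and the line; as a constant it can carry the
    sigma-finiteness that Fubini's theorem asks of the first factor. *)
Definition leb2 : set (measurableTypeR R * measurableTypeR R) -> \bar R := (leb \x leb)%E.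
HB.instance Definition _ := Measure.on leb2.

Lemma measurable_cube2 a : measurable (cube (R * R)%type a).
Proof. by rewrite cube_prod; apply: measurableX; exact: measurable_cube1. Qed.

Lemma cube2_fin a : (leb2 (cube (R * R)%type a) < +oo)%E.
Proof.
rewrite cube_prod /leb2 product_measure1E; [|exact: measurable_cube1..].
by rewrite lte_mul_pinfty// ?ge0_fin_numE ?cube1_fin.
Qed.

Lemma bigcup_cube (V : normedModType R) : \bigcup_n cube V n%:R = setT.
Proof.
apply/seteqP; split => // x _; exists (Num.truncn `|x|).+1 => //.
by rewrite /cube/= ltW// truncnS_gt.
Qed.

Lemma leb2_sigma_finite : sigma_finite setT leb2.
Proof.
exists (fun n => cube (R * R)%type n%:R); first by rewrite bigcup_cube.
by move=> n; split; [exact: measurable_cube2|exact: cube2_fin].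
Qed.
HB.instance Definition _ := Measure_isSigmaFinite.Build _ _ _ leb2 leb2_sigma_finite.

Lemma measurable_cube3 a : measurable (cube (R3 R) a).
Proof. by rewrite cube_prod; apply: measurableX; [exact: measurable_cube2|exact: measurable_cube1]. Qed.

Lemma leb3_cube a : leb3 (cube (R3 R) a) = (leb (cube R a) * leb (cube R a) * leb (cube R a))%E.
Proof.
rewrite !cube_prod /leb3 product_measure1E; [|by apply: measurableX; exact: measurable_cube1|exact: measurable_cube1].
by congr (_ * _)%E; apply: (product_measure1E leb leb); exact: measurable_cube1.
Qed.

Lemma cube3_fin a : (leb3 (cube (R3 R) a) < +oo)%E.
Proof.
by rewrite leb3_cube !lte_mul_pinfty// ?fin_numM ?ge0_fin_numE ?cube1_fin ?mule_ge0.
Qed.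

Lemma leb3_sigma_finite : sigma_finite setT (@leb3 R).
Proof.
exists (fun n => cube (R3 R) n%:R); first by rewrite bigcup_cube.
by move=> n; split; [exact: measurable_cube3|exact: cube3_fin].
Qed.
HB.instance Definition _ := Measure_isSigmaFinite.Build _ _ _ (@leb3 R) leb3_sigma_finite.

Lemma measurable_cube33 a : measurable (cube (R3 R * R3 R)%type a).
Proof. by rewrite cube_prod; apply: measurableX; exact: measurable_cube3. Qed.

Lemma cube33_fin a : ((@leb3 R \x @leb3 R)%E (cube (R3 R * R3 R)%type a) < +oo)%E.
Proof.
rewrite cube_prod product_measure1E; [|exact: measurable_cube3..].
by rewrite lte_mul_pinfty// ?ge0_fin_numE ?cube3_fin.
Qed.

Lemma measurable_cube13 a : measurable (cube (R * R3 R)%type a).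
Proof. by rewrite cube_prod; apply: measurableX; [exact: measurable_cube1|exact: measurable_cube3]. Qed.

Lemma cube13_fin a : ((leb \x @leb3 R)%E (cube (R * R3 R)%type a) < +oo)%E.
Proof.
rewrite cube_prod product_measure1E; [|exact: measurable_cube1|exact: measurable_cube3].
by rewrite lte_mul_pinfty// ?ge0_fin_numE ?cube3_fin// cube1_fin.
Qed.

Lemma C0c_support (V : normedModType R) (f : V -> R) : C0c f ->
  exists a, forall x, ~ cube V a x -> f x = 0.
Proof. by move=> [_ [a fa]]; exists a => x; rewrite /cube/= => /negP; rewrite -ltNge => /fa. Qed.

Lemma proper_norm_R3 : proper_norm (R3 R).
Proof. by apply: proper_norm_prod (@proper_norm_real R); apply: proper_norm_prod (@proper_norm_real R); exact: proper_norm_real. Qed.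

Lemma proper_norm_RR3 : proper_norm (R * R3 R)%type.
Proof. by apply: proper_norm_prod proper_norm_R3; exact: proper_norm_real. Qed.

Lemma C0c_integrable1 (f : R -> R) : C0c f -> leb.-integrable setT (EFin \o f).
Proof.
move=> cf; have [M fM] := C0c_bounded (@proper_norm_real R) cf; have [a fa] := C0c_support cf.
apply: (@bounded_support_integrable _ _ _ leb _ _ _ (measurable_cube1 a) (cube1_fin a) _ fM fa).
exact: continuous_measurable_fun (proj1 cf).
Qed.

Lemma C0c_integrable (f : R3 R -> R) : C0c f -> leb3.-integrable setT (EFin \o f).
Proof.
move=> cf; have [M fM] := C0c_bounded proper_norm_R3 cf; have [a fa] := C0c_support cf.
apply: (@bounded_support_integrable _ _ _ leb3 _ _ _ (measurable_cube3 a) (cube3_fin a) _ fM fa).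
exact: continuous_measurable_R3 (proj1 cf).
Qed.

End Cubes.
Arguments cube {R} V a.
(** * Directional derivatives and their integrals *)

Section LineDerivatives.
Context {R : realType} {V : normedModType R}.

(** Directional derivatives are derivatives of a function of one real variable, which is how
    one-dimensional calculus reaches functions on R^3 and on space-time. *)
Lemma is_derive_lineP (f : V -> R) (x v : V) (h : R) (df : R) :
  is_derive (x + h *: v) v f df <-> is_derive h (1 : R) (fun s : R => f (x + s *: v)) df.
Proof.
have E : (fun k : R => k^-1 *: ((f \o shift (x + h *: v)) (k *: v) - f (x + h *: v))) =
    (fun k : R => k^-1 *: (((fun s => f (x + s *: v)) \o shift h) (k *: (1 : R)) - f (x + h *: v))).
  apply/funext => k /=; congr (_ *: (f _ - _)).
  by rewrite [k *: 1]mulr1 scalerDl addrCA.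
split=> -[d <-]; split; try (by rewrite /derive E); move: d; by rewrite /derivable E.
Qed.

Lemma derivative_eq0 (f : V -> R) (x v : V) (df a : R) :
  (forall y : V, a < `|y| -> f y = 0) -> a < `|x| -> is_derive x v f df -> df = 0.
Proof.
move=> f0 ax fdf.
have c0 : is_derive x v f 0.
  apply: (@near_eq_is_derive R V R (cst 0) f x v 0 _ (is_derive_cst _ _ _)).
  near=> y; rewrite f0//; near: y.
  apply: (@open_nbhs_nbhs _ x); split => //.
  apply: (@open_comp _ _ (fun y : V => `|y|) [set r | a < r]) => [y _|].
    exact: norm_continuous.
  exact: open_gt.
by rewrite -(@derive_val _ _ _ _ _ _ _ fdf) (@derive_val _ _ _ _ _ _ _ c0).
Unshelve. all: by end_near. Qed.

(** The derivative A' along v is part of the data, so that it can be given by a formula. *)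
Definition C1c (v : V) (A A' : V -> R) :=
  [/\ C0c A, continuous A' & forall x, is_derive x v A (A' x)].

Lemma C1c_C0c v A A' : C1c v A A' -> C0c A'.
Proof.
move=> [[cA [a A0]] cA' dA]; split => //; exists a => x ax.
exact: derivative_eq0 A0 ax (dA x).
Qed.

End LineDerivatives.

Section IntegralOfDerivative.
Context {R : realType}.
Local Notation leb := (@lebesgue_measure R).

Lemma is_derive_continuous (g : R -> R) (t dg : R) : is_derive t (1 : R) g dg -> {for t, continuous g}.
Proof. by move=> [/derivable1_diffP dg' _]; exact: differentiable_continuous. Qed.

Lemma FTC2_closed (g g' : R -> R) (a b : R) : a <= b ->
  continuous g' -> (forall t : R, is_derive t (1 : R) g (g' t)) ->
  (\int[leb]_(t in `[a, b]) (g' t)%:E = (g b - g a)%:E)%E.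
Proof.
rewrite le_eqVlt => /predU1P[-> _ _|ab cg' dg].
  by rewrite set_itv1 integral_set1 subrr.
have cg t : {for t, continuous g} by exact: is_derive_continuous (dg t).
rewrite (@continuous_FTC2 _ g' g a b) ?EFinB//.
- exact: continuous_subspaceT.
- split; first by move=> t _; case: (dg t).
  + exact: cvg_at_right_filter (cg a).
  + exact: cvg_at_left_filter (cg b).
- by move=> t _; rewrite derive1E; exact: (@derive_val _ _ _ _ _ _ _ (dg t)).
Qed.

Lemma integral_derivative_eq0 (g g' : R -> R) (a : R) :
  continuous g' -> (forall t : R, is_derive t (1 : R) g (g' t)) ->
  (forall t, a < `|t| -> g t = 0) -> (\int[leb]_t (g' t)%:E = 0)%E.
Proof.
move=> cg' dg g0; pose b : R := `|a| + 1.
have ab : a < b by rewrite (le_lt_trans (ler_norm a))// ltrDl.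
have b0 : 0 <= b by rewrite addr_ge0.
have bb : - b <= b by rewrite ge0_cp.
have <- : (\int[leb]_(t in `[(- b)%R, b]) (g' t)%:E = 0)%E.
  by rewrite (FTC2_closed bb cg' dg) !g0 ?subrr// ?normrN ger0_norm.
rewrite [RHS]integral_mkcond; apply: eq_integral => t _; rewrite patchE.
case: ifPn => // /negP; rewrite inE/= in_itv/= -ler_norml => /negP; rewrite -ltNge => bt.
by congr EFin; exact: derivative_eq0 g0 (lt_trans ab bt) (dg t).
Qed.

Local Notation E := (R3 R).

(** By Fubini the integral is an iterated one whose inner integral runs along the i-th axis,
    and there the integral of a derivative of bounded support is zero. *)
Lemma integral_C1c (i : 'I_3) (A A' : E -> R) : C1c (basis3 i) A A' ->
  (\int[leb3]_x (A' x)%:E = 0)%E.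
Proof.
move=> HA; have ccA' := C1c_C0c HA; have iA' := C0c_integrable ccA'.
have [[cA [a A0]] cA' dA] := HA.
have slice (y : E) (w : R -> E) : (forall t, w t = y + t *: basis3 i) ->
    (forall t, `|t| <= `|w t|) ->
    (\int[leb]_t (A' (w t))%:E = 0)%E.
  move=> wE wn.
  have cw : continuous w.
    rewrite (funext wE) => t; apply: (@cvgD _ _ _ _ _ (cst y)); first exact: cvg_cst.
    by apply: cvgZr_tmp; exact: cvg_id.
  apply: (@integral_derivative_eq0 (A \o w) (A' \o w) a).
  - by move=> t; apply: continuous_comp; [exact: cw|exact: cA'].
  - move=> t; rewrite (_ : A \o w = fun s => A (y + s *: basis3 i)); last first.
      by apply/funext => s; rewrite -wE.
    rewrite [(_ \o _) t](_ : _ = A' (y + t *: basis3 i)); last by rewrite -wE.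
    exact: (proj1 (is_derive_lineP A y (basis3 i) t _) (dA _)).
  - by move=> t at_; apply: A0; exact: lt_le_trans (wn t).
have [M AM] := C0c_bounded (@proper_norm_R3 R) ccA'.
have [b Ab] := C0c_support ccA'.
have i2 c : leb2.-integrable setT (fun p : R * R => (A' (p, c))%:E).
  apply: (@bounded_support_integrable _ _ _ leb2 _ (fun p : R * R => A' (p, c)) _ (measurable_cube2 b) (cube2_fin b)).
  - exact: (measurableT_comp (continuous_measurable_R3 cA') (pair2_measurable c)).
  - by move=> p; exact: AM.
  - by move=> p pb; apply: Ab; move: pb; rewrite /cube/= => pb; rewrite prod_normE/= ge_max => /andP[].
case: i slice {HA dA} => -[|[|[|//]]] i3 slice.
- rewrite -(@integral21_prod_meas1 _ _ _ _ _ leb2 leb _ iA').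
  apply: integral0_eq => c _; rewrite /fubini_G.
  rewrite -(@integral21_prod_meas1 _ _ _ _ _ leb leb _ (i2 c)).
  apply: integral0_eq => t2 _; apply: (slice ((0, t2), c) (fun t => ((t, t2), c))).
  + move=> t; transitivity ((0 + t * 1 : R, t2 + t * 0 : R, c + t * 0 : R)); last by [].
    by rewrite mulr1 mulr0 add0r !addr0.
  + by move=> t; rewrite !prod_normE/= !le_max lexx.
- rewrite -(@integral21_prod_meas1 _ _ _ _ _ leb2 leb _ iA').
  apply: integral0_eq => c _; rewrite /fubini_G.
  rewrite -(@integral12_prod_meas1 _ _ _ _ _ leb leb _ (i2 c)).
  apply: integral0_eq => t1 _; apply: (slice ((t1, 0), c) (fun t => ((t1, t), c))).
  + move=> t; transitivity ((t1 + t * 0 : R, 0 + t * 1 : R, c + t * 0 : R)); last by [].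
    by rewrite mulr1 mulr0 add0r !addr0.
  + by move=> t; rewrite !prod_normE/= !le_max lexx orbT.
- rewrite -(@integral12_prod_meas1 _ _ _ _ _ leb2 leb _ iA').
  apply: integral0_eq => -[t1 t2] _; apply: (slice ((t1, t2), 0) (fun t => ((t1, t2), t))).
  + move=> t; transitivity ((t1 + t * 0 : R, t2 + t * 0 : R, 0 + t * 1 : R)); last by [].
    by rewrite mulr1 mulr0 add0r !addr0.
  + by move=> t; rewrite !prod_normE/= !le_max lexx orbT.
Qed.

End IntegralOfDerivative.

(** * Calculus of directional derivatives *)

Section Calculus.
Context {R : realType}.
Section OnV.
Context {V : normedModType R}.
Implicit Types (f g : V -> R) (x v : V).

Lemma is_derive_mul f g x v (df dg : R) : is_derive x v f df -> is_derive x v g dg ->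
  is_derive x v (fun y => f y * g y) (df * g x + f x * dg).
Proof.
move=> hf hg; apply: is_derive_eq (is_deriveM hf hg) _.
by rewrite [LHS]addrC; congr (_ + _); exact: mulrC.
Qed.

Lemma is_derive_add f g x v (df dg : R) : is_derive x v f df -> is_derive x v g dg ->
  is_derive x v (fun y => f y + g y) (df + dg).
Proof. by move=> hf hg; exact: (is_deriveD hf hg). Qed.

Lemma is_derive_scale f x v (c df : R) : is_derive x v f df ->
  is_derive x v (fun y => c * f y) (c * df).
Proof. by move=> hf; exact: (is_deriveZ c hf). Qed.

Lemma is_derive_const x v (c : R) : is_derive x v (fun _ : V => c) 0.
Proof. exact: is_derive_cst. Qed.

Lemma is_derive_chain (F : R -> R) f x v (dF df : R) : is_derive x v f df ->
  is_derive (f x) (1 : R) F dF -> is_derive x v (fun y => F (f y)) (dF * df).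
Proof.
move=> hf hF; have x0 : x = x + 0 *: v by rewrite scale0r addr0.
move: hf; rewrite {1}x0 => /is_derive_lineP hf; rewrite [x in is_derive x]x0; apply/is_derive_lineP.
have hF' : is_derive (f (x + 0 *: v)) (1 : R) F dF by rewrite -x0.
apply: DeriveDef.
  apply/derivable1_diffP; apply: (@differentiable_comp _ _ _ _ (fun s : R => f (x + s *: v)) F).
    by apply/derivable1_diffP; case: hf.
  by apply/derivable1_diffP; case: hF'.
have [[df0 _] [dF0 _]] := (hf, hF').
have := @derive1_comp _ (fun s : R => f (x + s *: v)) F 0 df0 dF0.
rewrite !derive1E => ->.
by rewrite (@derive_val _ _ _ _ _ _ _ hf) (@derive_val _ _ _ _ _ _ _ hF').
Qed.

(** As [C1c], without the condition on the support. *)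
Definition C1 v g g' := [/\ continuous g, continuous g' & forall x, is_derive x v g (g' x)].

Lemma continuous_mul f g : continuous f -> continuous g -> continuous (fun x => f x * g x).
Proof. by move=> cf cg x; apply: cvgM; [exact: cf|exact: cg]. Qed.

Lemma continuous_add f g : continuous f -> continuous g -> continuous (fun x => f x + g x).
Proof. by move=> cf cg x; apply: cvgD; [exact: cf|exact: cg]. Qed.

Lemma continuous_const (c : R) : continuous (fun _ : V => c).
Proof. by move=> x; exact: cvg_cst. Qed.

Lemma C1_mul v f f' g g' : C1 v f f' -> C1 v g g' ->
  C1 v (fun x => f x * g x) (fun x => f' x * g x + f x * g' x).
Proof.
move=> [cf cf' df] [cg cg' dg]; split; first exact: continuous_mul.
  by apply: continuous_add; exact: continuous_mul.
by move=> x; exact: is_derive_mul.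
Qed.

Lemma C1_add v f f' g g' : C1 v f f' -> C1 v g g' ->
  C1 v (fun x => f x + g x) (fun x => f' x + g' x).
Proof.
move=> [cf cf' df] [cg cg' dg]; split; [exact: continuous_add..|].
by move=> x; exact: is_derive_add.
Qed.

Lemma C1_const v (c : R) : C1 v (fun _ => c) (fun _ => 0).
Proof. by split; [exact: continuous_const..|move=> x; exact: is_derive_const]. Qed.

Lemma C1_scale v (c : R) f f' : C1 v f f' -> C1 v (fun x => c * f x) (fun x => c * f' x).
Proof.
move=> [cf cf' df]; split.
- by apply: continuous_mul => //; exact: continuous_const.
- by apply: continuous_mul => //; exact: continuous_const.
- by move=> x; exact: is_derive_scale.
Qed.

Lemma C1_chain v (F F' : R -> R) g g' : C1 v g g' ->
  (forall x, {for g x, continuous F'}) ->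
  (forall x, is_derive (g x) (1 : R) F (F' (g x))) ->
  C1 v (fun x => F (g x)) (fun x => F' (g x) * g' x).
Proof.
move=> [cg cg' dg] cF' dF; split.
- move=> x; apply: (@continuous_comp _ _ _ g F); first exact: cg.
  exact: is_derive_continuous (dF x).
- apply: continuous_mul => // x; apply: (@continuous_comp _ _ _ g F'); first exact: cg.
  exact: cF'.
- by move=> x; exact: is_derive_chain.
Qed.

Lemma C1c_mul v A A' g g' : C1c v A A' -> C1 v g g' ->
  C1c v (fun x => A x * g x) (fun x => A' x * g x + A x * g' x).
Proof.
move=> [[cA [a A0]] cA' dA] [cg cg' dg]; split.
- split; first exact: continuous_mul.
  by exists a => x ax; rewrite A0// mul0r.
- by apply: continuous_add; exact: continuous_mul.
- by move=> x; exact: is_derive_mul.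
Qed.

Lemma C1c_eq v A A' B B' : C1c v A A' -> A =1 B -> A' =1 B' -> C1c v B B'.
Proof. by move=> H /funext <- /funext <-. Qed.

Lemma C1_eq v A A' B B' : C1 v A A' -> A =1 B -> A' =1 B' -> C1 v B B'.
Proof. by move=> H /funext <- /funext <-. Qed.

Lemma C1c_C1 v A A' : C1c v A A' -> C1 v A A'.
Proof. by move=> [[? ?] ? ?]. Qed.

Lemma C1_C1c v A A' : C1 v A A' -> (exists a : R, forall x, a < `|x| -> A x = 0) -> C1c v A A'.
Proof. by move=> [? ? ?] ?. Qed.

End OnV.

Local Notation E := (R3 R).

Lemma sum3 (F : 'I_3 -> R) : \sum_i F i = F 0 + F 1 + F 2.
Proof.
rewrite !big_ord_recr big_ord0/= add0r; congr (_ + _ + _); congr F; exact/val_inj.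
Qed.

Lemma coord3_continuous i : continuous (@coord3 R i).
Proof.
case: i => -[|[|[|//]]] i3 x; rewrite /coord3/=.
- by apply: (@continuous_comp _ _ _ fst fst); exact: cvg_fst.
- by apply: (@continuous_comp _ _ _ fst snd); [exact: cvg_fst|exact: cvg_snd].
- exact: cvg_snd.
Qed.

Lemma coord3D i (x y : E) : coord3 i (x + y) = coord3 i x + coord3 i y.
Proof. by rewrite /coord3; case: ifP => // _; case: ifP. Qed.

Lemma coord3N i (x : E) : coord3 i (- x) = - coord3 i x.
Proof. by rewrite /coord3; case: ifP => // _; case: ifP. Qed.

Lemma coord3B i (x y : E) : coord3 i (x - y) = coord3 i x - coord3 i y.
Proof. by rewrite coord3D coord3N. Qed.

Lemma coord3Z i (c : R) (x : E) : coord3 i (c *: x) = c * coord3 i x.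
Proof. by rewrite /coord3; case: ifP => // _; case: ifP. Qed.

Lemma coord3_basis3 i j : coord3 i (basis3 j) = (i == j)%:R :> R.
Proof. by case: i => -[|[|[|//]]] ?; case: j => -[|[|[|//]]] ?. Qed.

Lemma C1_coord3 i v : C1 v (@coord3 R i) (fun _ => coord3 i v).
Proof.
split; [exact: coord3_continuous|exact: continuous_const|move=> x].
have x0 : x = x + 0 *: v by rewrite scale0r addr0.
rewrite x0; apply/is_derive_lineP.
rewrite (_ : (fun s => _) = (fun s : R => coord3 i x + coord3 i v * s)); last first.
  by apply/funext => s; rewrite coord3D coord3Z mulrC.
apply: is_derive_eq (is_derive_add (is_derive_const _ _ _) (is_derive_scale _ (is_derive_id _ _))) _.
by rewrite add0r mulr1.
Qed.

Lemma C1_shift v (c : E) g g' : C1 v g g' -> C1 v (fun x => g (x - c)) (fun x => g' (x - c)).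
Proof.
move=> [cg cg' dg].
have cs : continuous (fun x : E => x - c) by move=> x; apply: cvgB; [exact: cvg_id|exact: cvg_cst].
split; [|
  by move=> x; apply: (@continuous_comp _ _ _ (fun x : E => x - c) g'); [exact: cs|exact: cg']|].
  by move=> x; apply: (@continuous_comp _ _ _ (fun x : E => x - c) g); [exact: cs|exact: cg].
move=> x; have := dg (x - c); rewrite {1}(_ : x - c = x - c + 0 *: v); last by rewrite scale0r addr0.
move=> /is_derive_lineP H; rewrite {1}(_ : x = x + 0 *: v); last by rewrite scale0r addr0.
apply/is_derive_lineP; rewrite (_ : (fun s => _) = (fun s : R => g (x - c + s *: v)))//.
by apply/funext => s; rewrite addrAC.
Qed.

End Calculus.

(** * The Newtonian kernel and its regularization *)

Section RegularizedKernel.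
Context {R : realType}.
Local Notation E := (R3 R).

Definition sqnorm (z : E) : R := \sum_i coord3 i z ^+ 2.

Lemma sqnorm_ge0 z : 0 <= sqnorm z.
Proof. by apply: sumr_ge0 => i _; exact: sqr_ge0. Qed.

Definition dot (z v : E) : R := \sum_i coord3 i z * coord3 i v.

Lemma C1_sqnorm v : C1 v sqnorm (fun z => 2 * dot z v).
Proof.
have H i := C1_mul (C1_coord3 i v) (C1_coord3 i v).
apply: C1_eq (C1_add (C1_add (H 0) (H 1)) (H 2)) _ _ => z.
  by rewrite /sqnorm sum3 !expr2.
rewrite /dot sum3 !mulrDr.
by congr (_ + _ + _); rewrite mulrC -mulr2n mulr_natl.
Qed.

Variable d : R.
Hypothesis d0 : 0 < d.

(** The positive number d smooths the singularity at s = 0 of the inverse square root. *)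
Definition invsqrt (s : R) := (Num.sqrt (s + d))^-1.

Lemma is_derive_invsqrt (s : R) : 0 <= s ->
  is_derive s (1 : R) invsqrt (- 2^-1 * invsqrt s ^+ 3).
Proof.
move=> s0; have sd : 0 < s + d by rewrite ltr_wpDl.
have q0 : Num.sqrt (s + d) != 0 by rewrite gt_eqF// sqrtr_gt0.
have ds : is_derive s (1 : R) (fun t => t + d) 1.
  by apply: is_derive_eq (is_derive_add (is_derive_id _ _) (is_derive_const _ _ _)) _; rewrite addr0.
have dq := is_derive_chain ds (is_derive1_sqrt sd).
have dV := @is_deriveV _ (fun y => Num.sqrt (y + d)) s _ 1 q0 dq.
apply: is_derive_eq dV _.
rewrite /invsqrt; change (- Num.sqrt (s + d) ^- 2 * ((2 * Num.sqrt (s + d))^-1 * 1) =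
  - 2^-1 * (Num.sqrt (s + d))^-1 ^+ 3).
by move: q0; set q := Num.sqrt _ => q0; field.
Qed.

Lemma continuous_invsqrt (s : R) : 0 <= s -> {for s, continuous invsqrt}.
Proof. by move=> s0; exact: is_derive_continuous (is_derive_invsqrt s0). Qed.

(** The inverse distance 1 / |z| is s / |z|^3 with s = |z|^2.  Regularizing only the cube in the
    denominator gives a profile that is C^1, is bounded by the exact one and tends to it also
    at s = 0, where both are 0 because the inverse of 0 is 0. *)
Definition kernel_profile (s : R) : R := s * invsqrt s ^+ 3.
Definition kernel_profile' (s : R) : R := invsqrt s ^+ 3 - 3 / 2 * s * invsqrt s ^+ 5.

Lemma is_derive_kernel_profile (s : R) : 0 <= s -> is_derive s (1 : R) kernel_profile (kernel_profile' s).
Proof.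
move=> s0; have di := is_derive_invsqrt s0.
have d3 := is_derive_mul di (is_derive_mul di di).
rewrite (_ : kernel_profile = fun t => t * (invsqrt t * (invsqrt t * invsqrt t))); last first.
  by apply/funext => t; rewrite /kernel_profile !exprS expr0 mulr1.
apply: is_derive_eq (is_derive_mul (is_derive_id _ _) d3) _.
by rewrite /kernel_profile'/=; set r := invsqrt s; field.
Qed.

Lemma continuous_kernel_profile' (s : R) : 0 <= s -> {for s, continuous kernel_profile'}.
Proof.
move=> s0; have ci := continuous_invsqrt s0.
have cn n : (fun t => invsqrt t ^+ n) x @[x --> s] --> invsqrt s ^+ n.
  by apply: (@continuous_comp _ _ _ invsqrt (fun x => x ^+ n)); [exact: ci|exact: exprn_continuous].
apply: cvgB; first exact: cn.
by apply: cvgM; [apply: cvgM; [exact: cvg_cst|exact: cvg_id]|exact: cn].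
Qed.

Lemma invsqrt_ge0 s : 0 <= invsqrt s.
Proof. by rewrite invr_ge0 sqrtr_ge0. Qed.

Lemma kernel_profile_ge0 s : 0 <= s -> 0 <= kernel_profile s.
Proof. by move=> s0; rewrite mulr_ge0// exprn_ge0// invsqrt_ge0. Qed.

Lemma kernel_profile_le s : 0 <= s -> kernel_profile s <= (Num.sqrt s)^-1.
Proof.
rewrite le_eqVlt => /predU1P[<-|s0]; first by rewrite /kernel_profile mul0r sqrtr0 invr0.
have sd : 0 < s + d by rewrite addr_gt0.
have r0 : invsqrt s <= (Num.sqrt s)^-1.
  by rewrite lef_pV2 ?posrE ?sqrtr_gt0// ler_wsqrtr// lerDl ltW.
apply: le_trans r0; rewrite /kernel_profile exprSr mulrA ler_piMl ?invsqrt_ge0//.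
rewrite /invsqrt exprVn sqr_sqrtr ?(ltW sd)// ler_pdivrMr// mul1r lerDl ltW//.
Qed.

Definition regK (z : E) : R := (4 * pi)^-1 * kernel_profile (sqnorm z).
Definition dregK (v z : E) : R := (4 * pi)^-1 * (kernel_profile' (sqnorm z) * (2 * dot z v)).

Lemma C1_regK v : C1 v regK (dregK v).
Proof.
apply: C1_scale; apply: C1_chain (C1_sqnorm v) _ _ => z.
  exact/continuous_kernel_profile'/sqnorm_ge0.
exact/is_derive_kernel_profile/sqnorm_ge0.
Qed.

Lemma pi4_gt0 : 0 < 4 * pi :> R.
Proof. by rewrite mulr_gt0// pi_gt0. Qed.

Lemma regK_ge0 z : 0 <= regK z.
Proof. by rewrite mulr_ge0 ?invr_ge0 ?(ltW pi4_gt0)// kernel_profile_ge0// sqnorm_ge0. Qed.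

Lemma regK_le z : regK z <= Psi z.
Proof.
by rewrite /regK /Psi [leRHS]invfM ler_pM2l ?invr_gt0 ?pi4_gt0//; exact/kernel_profile_le/sqnorm_ge0.
Qed.

Lemma sqnormN z : sqnorm (- z) = sqnorm z.
Proof. by apply: eq_bigr => i _; rewrite coord3N sqrrN. Qed.

Lemma regKN z : regK (- z) = regK z.
Proof. by rewrite /regK sqnormN. Qed.

End RegularizedKernel.

Section KernelLimit.
Context {R : realType}.
Local Notation E := (R3 R).

Lemma Psi_ge0 (z : E) : 0 <= Psi z.
Proof. by rewrite invr_ge0 mulr_ge0 ?sqrtr_ge0// ltW// pi4_gt0. Qed.

Lemma regK_cvg (z : E) : (fun n => regK n.+1%:R^-1 z) @ \oo --> Psi z.
Proof.
have -> : Psi z = (4 * pi)^-1 * (Num.sqrt (sqnorm z))^-1 by rewrite /Psi invfM.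
rewrite /regK; apply: cvgM; first exact: cvg_cst.
rewrite /kernel_profile.
have := sqnorm_ge0 z; rewrite le_eqVlt => /predU1P[<-|s0].
  rewrite sqrtr0 invr0 (_ : (fun n => _) = cst 0); first exact: cvg_cst.
  by apply/funext => n; rewrite mul0r.
have -> : (Num.sqrt (sqnorm z))^-1 = sqnorm z * (Num.sqrt (sqnorm z))^-1 ^+ 3.
  rewrite -[X in X * _](@sqr_sqrtr _ (sqnorm z)) ?ltW// exprVn !exprS expr0.
  by field; rewrite gt_eqF// sqrtr_gt0.
apply: cvgM; first exact: cvg_cst.
have H : (fun n => invsqrt n.+1%:R^-1 (sqnorm z)) @ \oo --> (Num.sqrt (sqnorm z))^-1.
  apply: cvgV; first by rewrite gt_eqF// sqrtr_gt0.
  have H : (fun n => sqnorm z + n.+1%:R^-1) @ \oo --> sqnorm z.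
    rewrite -[X in _ --> X]addr0; apply: cvgD; first exact: cvg_cst.
    exact: cvg_harmonic.
  exact: (continuous_cvg _ (@sqrt_continuous R _) H).
exact: (continuous_cvg _ (@exprn_continuous R 3 _) H).
Qed.

(** Psi is discontinuous at 0; it is measurable as a limit of regularized kernels. *)
Lemma measurable_Psi_sub : measurable_fun setT (fun z : E * E => Psi (z.1 - z.2)).
Proof.
apply: (@measurable_fun_cvg _ _ _ setT (fun n (z : E * E) => regK n.+1%:R^-1 (z.1 - z.2))) => [n|z _].
  apply: continuous_measurable_R3R3 => z.
  apply: (@continuous_comp _ _ _ (fun z : E * E => z.1 - z.2) (regK n.+1%:R^-1)).
    by apply: cvgB; [exact: cvg_fst|exact: cvg_snd].
  by case: (@C1_regK R n.+1%:R^-1 ltac:(by rewrite invr_gt0) 0) => + _ _; exact.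
exact: regK_cvg.
Qed.
End KernelLimit.

(** * Local integrability of the Newtonian kernel *)

Section NewtonPotential.
Context {R : realType}.
Local Notation E := (R3 R).
Local Notation leb := (@lebesgue_measure R).

Definition cube_at (x : E) (r : R) : set E := [set y | `|x - y| <= r].

Lemma cube_atE x r : cube_at x r =
  [set y : R | `|x.1.1 - y| <= r] `*` [set y | `|x.1.2 - y| <= r] `*` [set y | `|x.2 - y| <= r].
Proof.
apply/seteqP; split => -[[y1 y2] y3]; rewrite /cube_at/= !prod_normE/= !ge_max.
  by move=> /andP[/andP[]].
by move=> [[-> ->] ->].
Qed.

Lemma itv_at (x r : R) : [set y : R | `|x - y| <= r] = `[x - r, x + r]%classic.
Proof. by apply/seteqP; split => y /=; rewrite in_itv/= distrC ler_distl. Qed.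

Lemma measurable_cube_at x r : measurable (cube_at x r).
Proof.
rewrite cube_atE !itv_at; apply: measurableX; last exact: measurable_itv.
by apply: measurableX; exact: measurable_itv.
Qed.

Lemma leb3_cube_at x r : 0 < r -> leb3 (cube_at x r) = ((2 * r) ^+ 3)%:E.
Proof.
move=> r0; rewrite cube_atE !itv_at.
have H (t : R) : leb `[t - r, t + r]%classic = (2 * r)%:E.
  rewrite lebesgue_measure_itv/= lte_fin ltrD2l gtrN// -EFinB; congr EFin; ring.
rewrite /leb3 product_measure1E; [|by apply: measurableX; exact: measurable_itv|exact: measurable_itv].
rewrite [X in (X * _)%E](_ : _ = (2 * r * (2 * r))%:E); last first.
  rewrite EFinM -{1}(H x.1.1) -(H x.1.2).
  by apply: (product_measure1E leb leb); exact: measurable_itv.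
apply: etrans (congr1 (fun X => ((2 * r * (2 * r))%:E * X)%E) (H x.2)) _.
by rewrite -EFinM; congr EFin; ring.
Qed.

Lemma coord3_le_enorm i (z : E) : `|coord3 i z| <= enorm z.
Proof.
rewrite -sqrtr_sqr ler_wsqrtr// (bigD1 i)//= lerDl.
by apply: sumr_ge0 => j _; exact: sqr_ge0.
Qed.

Lemma norm_le_enorm (z : E) : `|z| <= enorm z.
Proof.
rewrite !prod_normE/= !ge_max.
by rewrite (coord3_le_enorm 0 z) (coord3_le_enorm 1 z) (coord3_le_enorm 2 z).
Qed.

Lemma Psi_le_norm (z : E) : Psi z <= `|z|^-1.
Proof.
have [->|z0] := eqVneq z 0.
  rewrite normr0 invr0 /Psi (_ : enorm 0 = 0) ?mulr0 ?invr0//.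
  by rewrite /enorm big1 ?sqrtr0// => i _; rewrite /coord3; case: ifP => _; [|case: ifP => _]; rewrite expr0n.
rewrite lef_pV2 ?posrE ?normr_gt0//; last first.
  by rewrite mulr_gt0 ?pi4_gt0// (lt_le_trans _ (norm_le_enorm z))// normr_gt0.
apply: le_trans (norm_le_enorm z) _; rewrite ler_peMl ?sqrtr_ge0//.
have := @pi_ge2 R; lra.
Qed.

Definition dyadic (n : nat) : R := 2 ^- n.

Lemma dyadic_gt0 n : 0 < dyadic n.
Proof. by rewrite invr_gt0 exprn_gt0. Qed.

Lemma dyadicS n : dyadic n.+1 = dyadic n / 2.
Proof. by rewrite /dyadic exprS invfM mulrC. Qed.

(** The last dyadic radius that is still at least r. *)
Lemma dyadic_bound (r : R) : 0 < r -> r < 1 -> exists n, r <= dyadic n /\ r^-1 <= 2 / dyadic n.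
Proof.
move=> r0 r1; have [n] : exists n, dyadic n < r.
  exists (Num.truncn r^-1); rewrite /dyadic invf_plt ?posrE ?exprn_gt0//.
  apply: lt_le_trans (truncnS_gt _) _.
  by rewrite -natrX ler_nat ltn_expl.
elim: n => [|n IH]; first by rewrite /dyadic expr0 invr1 => /(lt_trans r1); rewrite ltxx.
have [/IH//|rn] := ltP (dyadic n) r.
move=> nr; exists n; split => //.
rewrite -[leRHS]invrK lef_pV2 ?posrE ?invr_gt0//; last by rewrite divr_gt0 ?dyadic_gt0.
apply: ltW; apply: le_lt_trans nr.
by rewrite invfM invrK mulrC -dyadicS.
Qed.

(** Cutting the unit cube into dyadic shells bounds Psi by a series of indicator functions of
    cubes, which can be integrated without spherical coordinates. *)
Lemma Psi_le_dyadic (z : E) : ((Psi z)%:E <= 1 +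
  \sum_(n <oo) (2 / dyadic n * \1_(cube E (dyadic n)) z)%:E)%E.
Proof.
have S0 n : (0 <= (2 / dyadic n * \1_(cube E (dyadic n)) z)%:E)%E.
  by rewrite lee_fin mulr_ge0// divr_ge0// ltW ?dyadic_gt0.
have [z1|z1] := leP 1 `|z|.
  apply: (@le_trans _ _ 1%E); last by rewrite leeDl// nneseries_ge0.
  rewrite lee_fin (le_trans (Psi_le_norm z))// invf_le1// (lt_le_trans _ z1)//.
have [z0|z0] := eqVneq z 0.
  apply: (@le_trans _ _ 0%E); last by rewrite adde_ge0// nneseries_ge0.
  by rewrite lee_fin (le_trans (Psi_le_norm z))// z0 normr0 invr0.
have [n [zn zn']] := dyadic_bound (ltac:(by rewrite normr_gt0) : 0 < `|z|) z1.
apply: (@le_trans _ _ (2 / dyadic n * \1_(cube E (dyadic n)) z)%:E).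
  rewrite lee_fin indicE mem_set// mulr1.
  exact: le_trans (Psi_le_norm z) zn'.
apply: le_trans (leeDr _ _) => //.
apply: le_trans (nneseries_lim_ge n.+1 (fun k _ _ => S0 k)).
by rewrite big_nat_recr//= leeDr// sume_ge0.
Qed.

(** The n-th term is 16 / 4^n. *)
Lemma dyadic_series : (\sum_(n <oo) (2 / dyadic n * (2 * dyadic n) ^+ 3)%:E <= (64 / 3)%:E)%E.
Proof.
apply: lime_le.
  apply: is_cvg_nneseries => n _ _.
  have q0 := dyadic_gt0 n; rewrite lee_fin mulr_ge0 ?divr_ge0 ?(ltW q0)//.
  by rewrite exprn_ge0// mulr_ge0// ltW.
near=> n; rewrite sumEFin lee_fin.
suff -> : \sum_(0 <= i < n) (2 / dyadic i * (2 * dyadic i) ^+ 3) = 64 / 3 * (1 - dyadic n ^+ 2).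
  by rewrite ler_piMr// lerBlDr lerDl exprn_ge0// ltW// dyadic_gt0.
elim: (n) => [|m IH]; first by rewrite big_geq// /dyadic expr0 invr1 expr1n subrr mulr0.
rewrite big_nat_recr//= IH dyadicS.
have := dyadic_gt0 m; set q := dyadic m => q0; field.
by rewrite gt_eqF.
Unshelve. all: by end_near. Qed.

(** The singularity 1 / |z| is integrable in dimension three, uniformly in the position of the
    pole: the cube of radius 2^-n has volume of order 8^-n, against a height of order 2^n. *)
Lemma Psi_cube_bound (a : R) : exists2 C : R, 0 <= C & forall x : E,
  (\int[leb3]_y (Psi (x - y) * \1_(cube E a) y)%:E <= C%:E)%E.
Proof.
have cf : leb3 (cube E a) \is a fin_num by rewrite ge0_fin_numE// cube3_fin.
exists (fine (leb3 (cube E a)) + 64 / 3); first by rewrite addr_ge0// fine_ge0.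
have mi : measurable_fun setT (\1_(cube E a) : E -> R).
  exact: (@measurable_indic _ _ R setT (cube E a : set E) (measurable_cube3 a)).
have mei : measurable_fun setT (fun y : E => (\1_(cube E a) y : R)%:E) by exact/measurable_EFinP.
move=> x.
pose g n (y : E) := ((2 / dyadic n * \1_(cube_at x (dyadic n)) y)%:E : \bar R).
have g0 n y : (0 <= g n y)%E.
  by rewrite lee_fin mulr_ge0// divr_ge0// ltW ?dyadic_gt0.
have mg n : measurable_fun setT (g n).
  apply/measurable_EFinP; apply: measurable_funM; first exact: measurable_cst.
  exact: (@measurable_indic _ _ R setT _ (measurable_cube_at x _)).
have ms : measurable_fun setT (fun y : E => \sum_(n <oo) g n y)%E.
  apply: ge0_emeasurable_sum => [n y _ _|n _]; first exact: g0.
  exact: mg.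
apply: (@le_trans _ _ (\int[leb3]_y ((\1_(cube E a) y)%:E + \sum_(n <oo) g n y))%E).
  apply: ge0_le_integral => //.
  - by move=> y _; rewrite lee_fin mulr_ge0// Psi_ge0.
  - apply/measurable_EFinP; apply: measurable_funM.
      exact: (measurableT_comp measurable_Psi_sub (pair1_measurable x)).
    exact: mi.
  - apply: emeasurable_funD; last exact: ms.
    exact: mei.
  - move=> y _; rewrite indicE; case: (boolP (y \in _)) => ya; last first.
      by rewrite mulr0 adde_ge0// nneseries_ge0.
    by rewrite mulr1; exact: Psi_le_dyadic.
have i0 (y : E) : setT y -> (0 <= (\1_(cube E a) y : R)%:E)%E by rewrite lee_fin.
have s0 (y : E) : setT y -> (0 <= \sum_(n <oo) g n y)%E by move=> _; rewrite nneseries_ge0.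
rewrite (ge0_integralD leb3 measurableT i0 mei s0 ms).
rewrite integral_indic ?setIT//; last exact: measurable_cube3.
rewrite EFinD fineK// leeD2l// integral_nneseries//.
apply: le_trans dyadic_series; apply: lee_nneseries => [n _ _|n _]; first exact: integral_ge0.
rewrite /g; under eq_integral do rewrite EFinM.
rewrite ge0_integralZl_EFin//; last 2 first.
  - by apply/measurable_EFinP; exact: (@measurable_indic _ _ R setT _ (measurable_cube_at x _)).
  - by rewrite divr_ge0// ltW ?dyadic_gt0.
rewrite [X in (_ * X)%E](_ : _ = ((2 * dyadic n) ^+ 3)%:E)//.
apply: etrans (leb3_cube_at x (dyadic_gt0 n)).
by rewrite (integral_indic leb3 measurableT (measurable_cube_at x _)) setIT.
Qed.

End NewtonPotential.

(** * Integration by parts against a regular kernel *)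

Section NewtonBilinear.
Context {R : realType}.
Local Notation E := (R3 R).
Local Notation leb33 := (@leb3 R \x @leb3 R)%E.

Section C0c_algebra.
Context {V : normedModType R}.
Implicit Types A B g : V -> R.

Lemma C0c_mulr A g : C0c A -> continuous g -> C0c (fun x => A x * g x).
Proof.
move=> [cA [a A0]] cg; split; first exact: continuous_mul.
by exists a => x ax; rewrite A0// mul0r.
Qed.

Lemma C0c_add A B : C0c A -> C0c B -> C0c (fun x => A x + B x).
Proof.
move=> [cA [a A0]] [cB [b B0]]; split; first exact: continuous_add.
by exists (Num.max a b) => x; rewrite gt_max => /andP[ax bx]; rewrite A0// B0// addr0.
Qed.

Lemma C0c_scale (c : R) A : C0c A -> C0c (fun x => c * A x).
Proof.
move=> [cA [a A0]]; split.
  by apply: continuous_mul => //; exact: continuous_const.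
by exists a => x ax; rewrite A0// mulr0.
Qed.

Lemma C0c_opp A : C0c A -> C0c (fun x => - A x).
Proof. by move=> /(C0c_scale (-1)); rewrite (_ : (fun x => -1 * A x) = (fun x => - A x))//; apply/funext => x; rewrite mulN1r. Qed.

Lemma C0c_sub A B : C0c A -> C0c B -> C0c (fun x => A x - B x).
Proof. by move=> cA /C0c_opp; exact: C0c_add. Qed.
End C0c_algebra.

Lemma continuous_pairr (T1 T2 : topologicalType) (x : T1) : continuous (fun y : T2 => (x, y)).
Proof. by move=> y; apply: cvg_pair => //; exact: cvg_cst. Qed.

Lemma continuous_pairl (T1 T2 : topologicalType) (x : T2) : continuous (fun y : T1 => (y, x)).
Proof. by move=> y; apply: cvg_pair => //; exact: cvg_cst. Qed.

Lemma continuous_section1 (P : E * E -> R) y : continuous P -> continuous (fun x => P (x, y)).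
Proof.
by move=> cP x; apply: (@continuous_comp _ _ _ (fun x : E => (x, y)) P); [exact: continuous_pairl|exact: cP].
Qed.

Lemma continuous_section2 (P : E * E -> R) x : continuous P -> continuous (fun y => P (x, y)).
Proof.
by move=> cP y; apply: (@continuous_comp _ _ _ (fun y : E => (x, y)) P); [exact: continuous_pairr|exact: cP].
Qed.

Lemma proper_norm_R3R3 : proper_norm (E * E)%type.
Proof. exact: proper_norm_prod proper_norm_R3 proper_norm_R3. Qed.

Lemma C0c_integrable33 (f : E * E -> R) : C0c f -> leb33.-integrable setT (EFin \o f).
Proof.
move=> cf; have [M fM] := C0c_bounded proper_norm_R3R3 cf; have [a fa] := C0c_support cf.
apply: (@bounded_support_integrable _ _ _ leb33 _ _ _ (measurable_cube33 a) (cube33_fin a) _ fM fa).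
exact: continuous_measurable_R3R3 (proj1 cf).
Qed.

Lemma continuous_fst_comp (A : E -> R) : continuous A -> continuous (fun z : E * E => A z.1).
Proof. by move=> cA z; apply: (@continuous_comp _ _ _ fst A); [exact: cvg_fst|exact: cA]. Qed.

Lemma continuous_snd_comp (A : E -> R) : continuous A -> continuous (fun z : E * E => A z.2).
Proof. by move=> cA z; apply: (@continuous_comp _ _ _ snd A); [exact: cvg_snd|exact: cA]. Qed.

Lemma continuous_sub_comp (A : E -> R) : continuous A -> continuous (fun z : E * E => A (z.1 - z.2)).
Proof.
move=> cA z; apply: (@continuous_comp _ _ _ (fun z : E * E => z.1 - z.2) A); last exact: cA.
by apply: cvgB; [exact: cvg_fst|exact: cvg_snd].
Qed.

Lemma C0c_tensor (P : E * E -> R) (A B : E -> R) : continuous P -> C0c A -> C0c B ->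
  C0c (fun z : E * E => P z * (A z.1 * B z.2)).
Proof.
move=> cP [cA [a A0]] [cB [b B0]]; split.
  apply: continuous_mul => //; apply: continuous_mul.
    exact: continuous_fst_comp.
  exact: continuous_snd_comp.
exists (Num.max a b) => -[x y] xy /=.
have [ax|ax] := ltP a `|x|; first by rewrite A0// mul0r mulr0.
have [bx|bx] := ltP b `|y|; first by rewrite B0// !mulr0.
by move: xy; rewrite ltNge prod_normE ge_max/= !le_max ax bx orbT.
Qed.

(** An abstract integration by parts.  For instance P (x, y) = K (x - y) and A', B' derivatives
    along an axis, with Q the derivative of P in x and hence - Q its derivative in y: both
    hypotheses say that the integral of a derivative is zero.  Adding and subtracting Q in the
    double integral and using the two orders of integration gives the claim.  The same scheme
    serves for any vector field whose flow preserves P and the volume. *)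
Lemma regularized_skew (P Q : E * E -> R) (A A' B B' : E -> R) :
  continuous P -> continuous Q -> C0c A -> C0c A' -> C0c B -> C0c B' ->
  (forall y, (\int[leb3]_x (A' x * P (x, y) + A x * Q (x, y))%:E = 0)%E) ->
  (forall x, (\int[leb3]_y (B' y * P (x, y) - B y * Q (x, y))%:E = 0)%E) ->
  \int[leb33]_z (P z * (A' z.1 * B z.2)) = - \int[leb33]_z (P z * (A z.1 * B' z.2)).
Proof.
move=> cP cQ cA cA' cB cB' HA HB.
have cPA' := C0c_tensor cP cA' cB; have cPB' := C0c_tensor cP cA cB'.
have cQAB := C0c_tensor cQ cA cB.
have i1 := C0c_integrable33 (C0c_add cPA' cQAB).
have i2 := C0c_integrable33 (C0c_sub cPB' cQAB).
apply/eqP; rewrite -subr_eq0 opprK -(RintegralD measurableT (C0c_integrable33 cPA') (C0c_integrable33 cPB')).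
rewrite (_ : (fun z => _) = (fun z => (P z * (A' z.1 * B z.2) + Q z * (A z.1 * B z.2)) +
   (P z * (A z.1 * B' z.2) - Q z * (A z.1 * B z.2)))); last first.
  by apply/funext => z; ring.
rewrite (RintegralD measurableT i1 i2) /Rintegral -(integral21_prod_meas1 i1) -(integral12_prod_meas1 i2).
rewrite !integral0_eq ?addr0// => [x _|y _]; rewrite /fubini_F /fubini_G/=.
  have iB : leb3.-integrable setT (EFin \o (fun y => B' y * P (x, y) - B y * Q (x, y))).
    apply: C0c_integrable; apply: C0c_sub; apply: C0c_mulr => //; exact: continuous_section2.
  transitivity (\int[leb3]_y ((A x)%:E * (B' y * P (x, y) - B y * Q (x, y))%:E))%E.
    by apply: eq_integral => y _; rewrite -EFinM; congr EFin; ring.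
  by rewrite (integralZl measurableT iB) HB mule0.
have iA : leb3.-integrable setT (EFin \o (fun x => A' x * P (x, y) + A x * Q (x, y))).
  apply: C0c_integrable; apply: C0c_add; apply: C0c_mulr => //; exact: continuous_section1.
transitivity (\int[leb3]_x ((B y)%:E * (A' x * P (x, y) + A x * Q (x, y))%:E))%E.
  by apply: eq_integral => x _; rewrite -EFinM; congr EFin; ring.
by rewrite (integralZl measurableT iA) HA mule0.
Qed.

End NewtonBilinear.

(** * The bilinear form of the Newtonian kernel *)

Section NewtonPairing.
Context {R : realType}.
Local Notation E := (R3 R).
Local Notation leb33 := (@leb3 R \x @leb3 R)%E.

Lemma Psi_section_integrable (B : E -> R) x : C0c B ->
  leb3.-integrable setT (EFin \o (fun y => Psi (x - y) * B y)).
Proof.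
move=> cB; have [M BM] := C0c_bounded (@proper_norm_R3 R) cB.
have [a Ba] := C0c_support cB; have [C C0 PsiC] := @Psi_cube_bound R a.
have mPsi : measurable_fun setT (fun y : E => Psi (x - y)).
  exact: (measurableT_comp measurable_Psi_sub (pair1_measurable x)).
have mi : measurable_fun setT (fun y : E => Psi (x - y) * \1_(cube E a) y).
  apply: measurable_funM => //.
  exact: (@measurable_indic _ _ R setT (cube E a : set E) (measurable_cube3 a)).
have M0 : 0 <= M by exact: le_trans (BM 0).
have iD : leb3.-integrable setT (fun y : E => (M%:E * (Psi (x - y) * \1_(cube E a) y)%:E)%E).
  apply: integrableZl => //; apply/integrableP; split; first exact/measurable_EFinP.
  apply: le_lt_trans (ltry C); apply: le_trans (PsiC x).
  rewrite le_eqVlt; apply/orP; left; apply/eqP; apply: eq_integral => y _.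
  by rewrite gee0_abs// lee_fin mulr_ge0// Psi_ge0.
apply: le_integrable iD => //.
  apply/measurable_EFinP; apply: measurable_funM => //.
  exact: continuous_measurable_R3 (proj1 cB).
move=> y _ /=; rewrite lee_fin !normrM (ger0_norm (Psi_ge0 _)) (ger0_norm M0) mulrCA.
rewrite ler_wpM2l// ?Psi_ge0//.
have [ya|ya] := pselect (cube E a y); last by rewrite Ba// normr0 mulr_ge0.
by rewrite indicE mem_set// normr1 mulr1.
Qed.

Lemma Psi_section_bounded (B : E -> R) : C0c B ->
  exists2 C : R, 0 <= C & forall x : E, (\int[leb3]_y `|(Psi (x - y) * B y)%:E| <= C%:E)%E.
Proof.
move=> cB; have [M BM] := C0c_bounded (@proper_norm_R3 R) cB.
have [a Ba] := C0c_support cB; have [C C0 PsiC] := @Psi_cube_bound R a.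
have M0 : 0 <= M by exact: le_trans (BM 0).
exists (M * C) => [|x]; first exact: mulr_ge0.
have mPsi : measurable_fun setT (fun y : E => Psi (x - y)).
  exact: (measurableT_comp measurable_Psi_sub (pair1_measurable x)).
have mi : measurable_fun setT (fun y : E => Psi (x - y) * \1_(cube E a) y).
  apply: measurable_funM => //.
  exact: (@measurable_indic _ _ R setT (cube E a : set E) (measurable_cube3 a)).
have mei : measurable_fun setT (fun y : E => (Psi (x - y) * \1_(cube E a) y)%:E).
  exact/measurable_EFinP.
apply: (@le_trans _ _ (\int[leb3]_y (M%:E * (Psi (x - y) * \1_(cube E a) y)%:E))%E).
  apply: ge0_le_integral => //.
  - apply: measurableT_comp => //; apply/measurable_EFinP; apply: measurable_funM => //.
    exact: continuous_measurable_R3 (proj1 cB).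
  - by apply: measurable_funeM; exact: mei.
  - move=> y _; rewrite lee_fin normrM (ger0_norm (Psi_ge0 _)) mulrCA.
    rewrite ler_wpM2l// ?Psi_ge0//.
    have [ya|ya] := pselect (cube E a y); last by rewrite Ba// normr0 mulr_ge0.
    by rewrite indicE mem_set// mulr1.
have i0 (y : E) : setT y -> (0 <= (Psi (x - y) * \1_(cube E a) y)%:E)%E.
  by move=> _; rewrite lee_fin mulr_ge0// Psi_ge0.
by rewrite (ge0_integralZl_EFin leb3 measurableT i0 mei M0) EFinM lee_wpmul2l// lee_fin.
Qed.

(** By Tonelli: the integral in y is bounded uniformly in x, and A is integrable. *)
Lemma Psi_tensor_integrable (A B : E -> R) : C0c A -> C0c B ->
  leb33.-integrable setT (EFin \o (fun z => Psi (z.1 - z.2) * (A z.1 * B z.2))).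
Proof.
move=> cA cB; have [C C0 BC] := Psi_section_bounded cB.
have mf : measurable_fun setT (EFin \o (fun z : E * E => Psi (z.1 - z.2) * (A z.1 * B z.2))).
  apply/measurable_EFinP; apply: measurable_funM; first exact: measurable_Psi_sub.
  apply: continuous_measurable_R3R3; apply: continuous_mul.
    exact: continuous_fst_comp (proj1 cA).
  exact: continuous_snd_comp (proj1 cB).
apply/(integrable12ltyP leb3 leb3 mf).
have [mA iA] := integrableP _ _ _ (C0c_integrable cA).
have H (x : E) : (\int[leb3]_y `|(Psi (x - y) * (A x * B y))%:E| <= C%:E * `|(A x)%:E|)%E.
  have -> : (\int[leb3]_y `|(Psi (x - y) * (A x * B y))%:E| =
      \int[leb3]_y (`|(A x)%:E| * `|(Psi (x - y) * B y)%:E|))%E.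
    by apply: eq_integral => y _; rewrite -abseM -EFinM; congr (`| _%:E |)%E; ring.
  rewrite muleC ge0_integralZl//; first exact: lee_wpmul2l.
  by apply: measurableT_comp => //; exact: measurable_int (Psi_section_integrable x cB).
apply: (@le_lt_trans _ _ (\int[leb3]_x (C%:E * `|(A x)%:E|))%E); last first.
  rewrite ge0_integralZl//; first by rewrite lte_mul_pinfty// ?lee_fin.
  exact: measurableT_comp.
apply: ge0_le_integral => //.
- by move=> x _; exact: integral_ge0.
- apply: (@measurable_fun_fubini_tonelli_F _ _ _ _ _ leb3 (fun z : E * E => `|(Psi (z.1 - z.2) * (A z.1 * B z.2))%:E|%E)) => //.
  exact: measurableT_comp.
- by apply: measurable_funeM; exact: measurableT_comp.
- by move=> x _; exact: H.
Qed.
End NewtonPairing.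

Section NewtonSkew.
Context {R : realType}.
Local Notation E := (R3 R).
Local Notation leb33 := (@leb3 R \x @leb3 R)%E.

(** The energy form of the Newtonian kernel. *)
Definition newton_form (A B : E -> R) : R := \int[leb33]_z (Psi (z.1 - z.2) * (A z.1 * B z.2)).

Definition reg_newton_form (d : R) (A B : E -> R) : R :=
  \int[leb33]_z (regK d (z.1 - z.2) * (A z.1 * B z.2)).

Lemma continuous_regK (d : R) : 0 < d -> continuous (regK d : E -> R).
Proof. by move=> d0; case: (C1_regK d0 (0 : E)). Qed.

Lemma continuous_dregK (d : R) (v : E) : 0 < d -> continuous (dregK d v).
Proof. by move=> d0; case: (C1_regK d0 v). Qed.

(** Dominated convergence, the regularized kernels being bounded by Psi. *)
Lemma reg_newton_form_cvg (A B : E -> R) : C0c A -> C0c B ->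
  (fun n => reg_newton_form n.+1%:R^-1 A B) @ \oo --> newton_form A B.
Proof.
move=> cA cB.
have iP := Psi_tensor_integrable cA cB.
have d0 n : (0 : R) < n.+1%:R^-1 by rewrite invr_gt0.
pose f_ n (z : E * E) := (regK n.+1%:R^-1 (z.1 - z.2) * (A z.1 * B z.2))%:E : \bar R.
have mf_ n : measurable_fun setT (f_ n).
  exact: measurable_int (C0c_integrable33 (C0c_tensor (continuous_sub_comp (continuous_regK (d0 n))) cA cB)).
have f_f (z : E * E) : setT z ->
    f_ ^~ z @ \oo --> (Psi (z.1 - z.2) * (A z.1 * B z.2))%:E.
  move=> _; apply: cvg_EFin; first by near=> n.
  by apply: cvgM; [exact: regK_cvg|exact: cvg_cst].
have f_g n (z : E * E) : setT z ->
    (`|f_ n z| <= `|(Psi (z.1 - z.2) * (A z.1 * B z.2))%:E|)%E.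
  move=> _; rewrite lee_fin normrM [leRHS]normrM ler_wpM2r//.
  by rewrite (ger0_norm (Psi_ge0 _)) ger0_norm ?regK_ge0// regK_le.
have fing (z : E * E) : setT z ->
  (`|(Psi (z.1 - z.2) * (A z.1 * B z.2))%:E|)%E \is a fin_num by [].
have := @dominated_cvg _ _ R leb33 setT measurableT f_ _ _ mf_ f_f fing (integrable_abse iP) f_g.
have -> : (\int[leb33]_z (Psi (z.1 - z.2) * (A z.1 * B z.2))%:E)%E = (newton_form A B)%:E.
  by rewrite /newton_form /Rintegral fineK//; exact: (integrable_fin_num measurableT iP).
exact: fine_cvg.
Unshelve. all: by end_near. Qed.

Lemma newton_form_skew (A A' B B' : E -> R) : C0c A -> C0c A' -> C0c B -> C0c B' ->
  (forall d : R, 0 < d -> reg_newton_form d A' B = - reg_newton_form d A B') ->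
  newton_form A' B = - newton_form A B'.
Proof.
move=> cA cA' cB cB' H.
apply: (@cvg_unique _ (@norm_hausdorff _ _) _ _ _ _ (reg_newton_form_cvg cA' cB)).
rewrite (_ : (fun n => _) = (fun n => - reg_newton_form n.+1%:R^-1 A B')); last first.
  by apply/funext => n; rewrite H// invr_gt0.
by apply: cvgN; exact: reg_newton_form_cvg.
Qed.

Lemma dotN (z v : E) : dot (- z) v = - dot z v.
Proof. by rewrite /dot -sumrN; apply: eq_bigr => i _; rewrite coord3N mulNr. Qed.

Lemma dot_basis3 (z : E) i : dot z (basis3 i) = coord3 i z.
Proof.
rewrite /dot (bigD1 i)//= coord3_basis3 eqxx mulr1 big1 ?addr0// => j ji.
by rewrite coord3_basis3 (negbTE ji) mulr0.
Qed.

Lemma dregKN (d : R) (v z : E) : dregK d v (- z) = - dregK d v z.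
Proof. by rewrite /dregK sqnormN dotN !mulrN. Qed.

(** The kernel depends on x - y only, so that its derivatives in x and in y are opposite.  A
    derivative of the test function in the pressure distribution thus passes through the kernel
    onto the tensor v (x) v. *)
Lemma newton_form_partial i (A A' B B' : E -> R) :
  C1c (basis3 i) A A' -> C1c (basis3 i) B B' -> newton_form A' B = - newton_form A B'.
Proof.
move=> hA hB; have [cA _ _] := hA; have [cB _ _] := hB.
apply: newton_form_skew (C1c_C0c hA) _ (C1c_C0c hB) _ => // d d0.
have hK := C1_regK d0 (basis3 i).
apply: (@regularized_skew _ (fun z => regK d (z.1 - z.2)) (fun z => dregK d (basis3 i) (z.1 - z.2))).
- exact: continuous_sub_comp (continuous_regK d0).
- exact: (continuous_sub_comp (@continuous_dregK d (basis3 i) d0)).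
- exact: cA.
- exact: C1c_C0c hA.
- exact: cB.
- exact: C1c_C0c hB.
- by move=> y; exact: integral_C1c (C1c_mul hA (C1_shift y hK)).
(* The kernel is even and its derivative is odd. *)
- move=> x; rewrite -[RHS](integral_C1c (C1c_mul hB (C1_shift x hK))).
  apply: eq_integral => y _; congr EFin; move: y => y0; set y : E := y0.
  by rewrite /= -[x - y]opprB regKN dregKN mulrN opprK.
Qed.

(** A' is the derivative of A along the field (-y, x, 0) of rotations about the vertical axis
    through c. *)
Definition rotational (c : E) (A A' : E -> R) := exists A0 A1 : E -> R,
  [/\ C1c (basis3 0) A A0, C1c (basis3 1) A A1 &
    forall x, A' x = coord3 0 (x - c) * A1 x - coord3 1 (x - c) * A0 x].

Lemma C1_coord_shift c i j :
  C1 (basis3 j) (fun x : E => coord3 i (x - c)) (fun _ => (i == j)%:R : R).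
Proof.
by have := C1_shift c (C1_coord3 i (basis3 j : E)); rewrite coord3_basis3.
Qed.

Lemma rotational_C0c c A A' : rotational c A A' -> C0c A'.
Proof.
move=> [A0 [A1 [h0 h1 /funext ->]]]; apply: C0c_sub.
  have := C0c_mulr (C1c_C0c h1) (let: And3 c _ _ := C1_coord_shift c 0 1 in c).
  by rewrite (_ : (fun x => A1 x * _) = (fun x => coord3 0 (x - c) * A1 x))//; apply/funext => x; rewrite mulrC.
have := C0c_mulr (C1c_C0c h0) (let: And3 c _ _ := C1_coord_shift c 1 0 in c).
by rewrite (_ : (fun x => A0 x * _) = (fun x => coord3 1 (x - c) * A0 x))//; apply/funext => x; rewrite mulrC.
Qed.

(** The rotation field is divergence free. *)
Lemma integral_rotational c A A' : rotational c A A' -> (\int[leb3]_x (A' x)%:E = 0)%E.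
Proof.
move=> [A0 [A1 [h0 h1 A'E]]].
have H0 := C1c_mul h0 (C1_coord_shift c 1 0); have H1 := C1c_mul h1 (C1_coord_shift c 0 1).
have i0 := C0c_integrable (C1c_C0c H0); have i1 := C0c_integrable (C1c_C0c H1).
transitivity (\int[leb3]_x ((A1 x * coord3 0 (x - c) + A x * (0 == 1 :> 'I_3)%:R)%:E -
    (A0 x * coord3 1 (x - c) + A x * (1 == 0 :> 'I_3)%:R)%:E))%E.
  by apply: eq_integral => x _; rewrite A'E -EFinB /= !mulr0 !addr0; congr EFin; ring.
by rewrite (integralB_EFin measurableT i1 i0) (integral_C1c H0) (integral_C1c H1) subee.
Qed.

Lemma rotational_mul c A A' g g0 g1 : rotational c A A' -> C1 (basis3 0) g g0 -> C1 (basis3 1) g g1 ->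
  rotational c (fun x => A x * g x)
    (fun x => A' x * g x + A x * (coord3 0 (x - c) * g1 x - coord3 1 (x - c) * g0 x)).
Proof.
move=> [A0 [A1 [h0 h1 A'E]]] hg0 hg1.
exists (fun x => A0 x * g x + A x * g0 x), (fun x => A1 x * g x + A x * g1 x).
split; [exact: C1c_mul|exact: C1c_mul|move=> x; rewrite A'E; ring].
Qed.

(** Invariance of |x - y| under simultaneous rotation of x and y: this is what makes the
    potential of a rotation-invariant source rotation invariant. *)
Lemma newton_form_rotational c (A A' B B' : E -> R) :
  rotational c A A' -> rotational c B B' -> newton_form A' B = - newton_form A B'.
Proof.
move=> hA hB; have cA : C0c A by case: hA => [? [? [[]]]].
have cB : C0c B by case: hB => [? [? [[]]]].
apply: newton_form_skew (rotational_C0c hA) _ (rotational_C0c hB) _ => // d d0.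
have hK0 := C1_regK d0 (basis3 0); have hK1 := C1_regK d0 (basis3 1).
apply: (@regularized_skew _ (fun z => regK d (z.1 - z.2))
  (fun z => coord3 0 (z.1 - c) * dregK d (basis3 1) (z.1 - z.2)
          - coord3 1 (z.1 - c) * dregK d (basis3 0) (z.1 - z.2))).
- exact: continuous_sub_comp (continuous_regK d0).
- have cc1 i : continuous (fun z : E * E => coord3 i (z.1 - c)).
    by apply: (@continuous_fst_comp _ (fun x => coord3 i (x - c))); case: (C1_coord_shift c i 0).
  have ck i : continuous (fun z : E * E => dregK d (basis3 i) (z.1 - z.2)).
    exact: (continuous_sub_comp (@continuous_dregK d (basis3 i) d0)).
  by move=> z; apply: cvgB; apply: cvgM; [exact: cc1|exact: ck|exact: cc1|exact: ck].
- exact: cA.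
- exact: rotational_C0c hA.
- exact: cB.
- exact: rotational_C0c hB.
- by move=> y; exact: integral_rotational (rotational_mul hA (C1_shift y hK0) (C1_shift y hK1)).
(* The rotation fields at x and at y differ by the one centred at 0, taken at
   x - y, and the latter annihilates the kernel. *)
- move=> x; rewrite -[RHS](integral_rotational (rotational_mul hB (C1_shift x hK0) (C1_shift x hK1))).
  apply: eq_integral => y _; congr EFin; move: y => y0; set y : E := y0.
  rewrite /= -[x - y]opprB regKN !dregKN /dregK !dot_basis3 !coord3B.
  ring.
Qed.
End NewtonSkew.

(** * Newtonian potentials *)

Section NewtonConvolution.
Context {R : realType}.
Local Notation E := (R3 R).
Local Notation leb33 := (@leb3 R \x @leb3 R)%E.

Lemma measurable_convolution (B : E -> R) : C0c B -> measurable_fun setT (convolution Psi B).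
Proof.
move=> cB; rewrite /convolution /Rintegral.
have mf : measurable_fun setT (fun z : E * E => (Psi (z.1 - z.2) * B z.2)%:E).
  apply/measurable_EFinP; apply: measurable_funM; first exact: measurable_Psi_sub.
  exact: continuous_measurable_R3R3 (continuous_snd_comp (proj1 cB)).
apply: measurableT_comp; first exact: fine_measurable.
have mp := @measurable_fun_fubini_tonelli_F _ _ _ _ _ leb3 _
  (measurable_funepos mf) (funepos_ge0 _).
have mn := @measurable_fun_fubini_tonelli_F _ _ _ _ _ leb3 _
  (measurable_funeneg mf) (funeneg_ge0 _).
apply: eq_measurable_fun (emeasurable_funB mp mn) => x _.
by rewrite [RHS]integralE /fubini_F; congr (_ - _)%E; apply: eq_integral => y _; rewrite ?funeposE ?funenegE.
Qed.

Lemma convolutionE (B : E -> R) x : C0c B ->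
  (convolution Psi B x)%:E = (\int[leb3]_y (Psi (x - y) * B y)%:E)%E.
Proof.
move=> cB; rewrite /convolution /Rintegral fineK//.
exact: (integrable_fin_num measurableT (Psi_section_integrable x cB)).
Qed.

Lemma convolution_bounded (B : E -> R) : C0c B ->
  exists C : R, forall x, `|convolution Psi B x| <= C.
Proof.
move=> cB; have [C C0 BC] := Psi_section_bounded cB; exists C => x.
rewrite -lee_fin -abse_EFin convolutionE//; apply: le_trans (BC x).
apply: le_abse_integral => //; exact: measurable_int (Psi_section_integrable x cB).
Qed.

Lemma bounded_mul_C0c_integrable (f A : E -> R) (C : R) : measurable_fun setT f ->
  (forall x, `|f x| <= C) -> C0c A -> leb3.-integrable setT (EFin \o (fun x => f x * A x)).
Proof.
move=> mf fC cA; have [M AM] := C0c_bounded (@proper_norm_R3 R) cA.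
have [a Aa] := C0c_support cA.
apply: (@bounded_support_integrable _ _ _ leb3 _ _ (C * M) (measurable_cube3 a) (cube3_fin a)).
- by apply: measurable_funM => //; exact: continuous_measurable_R3 (proj1 cA).
- by move=> x; rewrite normrM ler_pM.
- by move=> x xa; rewrite Aa// mulr0.
Qed.

Lemma integral_convolution (A B : E -> R) : C0c A -> C0c B ->
  \int[leb3]_x (convolution Psi B x * A x) = newton_form A B.
Proof.
move=> cA cB; rewrite /newton_form /Rintegral -(integral12_prod_meas1 (Psi_tensor_integrable cA cB)).
congr fine; apply: eq_integral => x _; rewrite /fubini_F/=.
transitivity (\int[leb3]_y ((A x)%:E * (Psi ((x : E) - y) * B y)%:E))%E; last first.
  by apply: eq_integral => y _; rewrite -EFinM; congr EFin; ring.
rewrite (integralZl measurableT (Psi_section_integrable (x : E) cB)) -convolutionE//.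
by rewrite mulrC EFinM.
Qed.

Lemma compact_measurable_R3 (K : set E) : compact K -> measurable K.
Proof.
move=> cK; rewrite -(setCK K); apply: measurableC.
apply: (measurable_base_open measurable_base_R3); apply: closed_openC.
by apply: compact_closed => //; exact: norm_hausdorff.
Qed.

Lemma compact_cube (V : normedModType R) (K : set V) : compact K ->
  exists a, K `<=` cube V a.
Proof.
move=> /compact_bounded[M [_ /(_ (`|M| + 1))]].
rewrite (le_lt_trans (ler_norm M))// ?ltrDl// => /(_ erefl) HM.
by exists (`|M| + 1) => x /HM.
Qed.

(** Local integrability is all that is asked of a pressure. *)
Lemma bounded_locally_integrable (f : E -> R) (C : R) : measurable_fun setT f ->
  (forall x, `|f x| <= C) -> locally_integrable3 f.
Proof.
move=> mf fC; split => // K cK; have mK := compact_measurable_R3 cK.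
apply: measurable_bounded_integrable => //.
- have [a Ka] := compact_cube cK.
  apply: le_lt_trans (cube3_fin a); apply: le_measure => //; rewrite inE//.
  exact: measurable_cube3.
- exact: measurable_funS mf.
- exists C; split; first exact: num_real.
  by move=> N CN x _; exact: le_trans (fC x) (ltW CN).
Qed.
End NewtonConvolution.

(** * The radial cut-off *)

Section SwirlProfile.
Context {R : realType}.
Local Notation E := (R3 R).

(** The k-th power of the positive part, which is of class C^(k-1). *)
Definition pos_pow (k : nat) (t : R) : R := Num.max 0 t ^+ k.

Lemma pos_pow_le0 k (t : R) : t <= 0 -> pos_pow k.+1 t = 0.
Proof. by move=> t0; rewrite /pos_pow max_l// expr0n. Qed.

Lemma pos_pow_ge0 k (t : R) : 0 <= t -> pos_pow k t = t ^+ k.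
Proof. by move=> t0; rewrite /pos_pow max_r. Qed.

Lemma pos_pow_nneg k (t : R) : 0 <= pos_pow k t.
Proof. by rewrite exprn_ge0// le_max lexx. Qed.

Lemma pos_powM m n (t : R) : pos_pow m t * pos_pow n t = pos_pow (m + n) t.
Proof. by rewrite /pos_pow exprD. Qed.

Lemma continuous_pos_pow k : continuous (pos_pow k).
Proof.
move=> t; apply: (@continuous_comp _ _ _ (fun t : R => Num.max 0 t) (fun s : R => s ^+ k)).
  by apply: continuous_max; [exact: cvg_cst|exact: cvg_id].
exact: exprn_continuous.
Qed.

(** Away from 0 the function is locally a polynomial.  At 0 its difference quotient is the next
    lower power of the positive part, which is continuous and vanishes there. *)
Lemma is_derive_pos_pow k (t : R) : is_derive t (1 : R) (pos_pow k.+2) (k.+2%:R * pos_pow k.+1 t).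
Proof.
have [t0|t0|->] := ltgtP t 0.
- rewrite pos_pow_le0 ?(ltW t0)// mulr0.
  apply: (@near_eq_is_derive _ _ _ (fun _ => 0) (pos_pow k.+2) t 1 0 _ (is_derive_cst _ _ _)).
  near=> s; rewrite pos_pow_le0//; apply: ltW; near: s.
  by apply: (@open_nbhs_nbhs _ t); split => //; exact: open_lt.
- rewrite pos_pow_ge0 ?(ltW t0)//.
  have H : is_derive t (1 : R) (fun s => s ^+ k.+2) (k.+2%:R * t ^+ k.+1).
    apply: DeriveDef; first exact: exprn_derivable.
    by rewrite exp_derive; exact: mulr1.
  have near_eq : \near t, (t : R) ^+ k.+2 = pos_pow k.+2 t; last first.
    exact: (@near_eq_is_derive R R R (fun s : R => s ^+ k.+2) (pos_pow k.+2) t 1 _ near_eq H).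
  near=> s; rewrite pos_pow_ge0//; apply: ltW; near: s.
  by apply: (@open_nbhs_nbhs _ t); split => //; exact: open_gt.
- rewrite pos_pow_le0// mulr0; apply/is_derive1_caratheodory; exists (pos_pow k.+1); split.
  + move=> z; rewrite (pos_pow_le0 _ (lexx 0)) !subr0.
    have [z0|z0] := leP z 0; first by rewrite !pos_pow_le0// mul0r.
    by rewrite !pos_pow_ge0 ?(ltW z0)// -exprSr.
  + exact: continuous_pos_pow.
  + exact: pos_pow_le0.
Unshelve. all: by end_near. Qed.

Variables (a : E) (rho : R).

Definition rel_coord (i : 'I_3) (x : E) : R := coord3 i (x - a).

Definition depth (x : E) : R := rho ^+ 2 - sqnorm (x - a).

Definition bump (k : nat) (x : E) : R := pos_pow k (depth x).

Lemma C1_rel_coord i j : C1 (basis3 j) (rel_coord i) (fun _ => (i == j)%:R).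
Proof. exact: C1_coord_shift. Qed.

Lemma C1_bump k j : C1 (basis3 j) (bump k.+2)
  (fun x => - 2 * k.+2%:R * rel_coord j x * bump k.+1 x).
Proof.
have Hd : C1 (basis3 j) depth (fun x => - 2 * rel_coord j x).
  apply: C1_eq (C1_add (C1_const _ (rho ^+ 2)) (C1_scale (-1) (C1_shift a (C1_sqnorm (basis3 j))))) _ _ => x.
    by rewrite mulN1r.
  by rewrite add0r dot_basis3 mulN1r mulNr.
apply: C1_eq (C1_chain (F := pos_pow k.+2) (F' := fun t => k.+2%:R * pos_pow k.+1 t) Hd _ _) _ _ => x //.
- by apply: cvgM; [exact: cvg_cst|exact: continuous_pos_pow].
- exact: is_derive_pos_pow.
- by rewrite /bump; ring.
Qed.

Lemma continuous_bump k : continuous (bump k).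
Proof.
move=> x; apply: (@continuous_comp _ _ _ depth (pos_pow k)); last exact: continuous_pos_pow.
apply: cvgB; first exact: cvg_cst.
by have [+ _ _] := C1_shift a (C1_sqnorm (0 : E)); exact.
Qed.

Hypothesis rho0 : 0 < rho.

Lemma bump_support k (x : E) : `|a| + rho < `|x| -> bump k.+1 x = 0.
Proof.
move=> ax; apply: pos_pow_le0; rewrite subr_le0.
have H : rho < enorm (x - a).
  apply: lt_le_trans (norm_le_enorm _); rewrite -(ltrD2l `|a|); apply: lt_le_trans ax _.
  by rewrite -{1}(subrK a x) addrC ler_normD.
by rewrite -(@sqr_sqrtr _ (sqnorm (x - a))) ?sqnorm_ge0// ler_sqr ?nnegrE ?sqrtr_ge0 ?(ltW rho0)// ltW.
Qed.

Lemma C0c_bump k g : continuous g -> C0c (fun x => bump k.+1 x * g x).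
Proof.
move=> cg; split; first by apply: continuous_mul => //; exact: continuous_bump.
by exists (`|a| + rho) => x ax; rewrite bump_support// mul0r.
Qed.

Lemma C1c_bump k j g g' : C1 (basis3 j) g g' -> C1c (basis3 j) (fun x => bump k.+2 x * g x)
  (fun x => - 2 * k.+2%:R * rel_coord j x * bump k.+1 x * g x + bump k.+2 x * g' x).
Proof.
move=> hg; apply: C1_C1c; first exact: C1_mul (C1_bump k j) hg.
by exists (`|a| + rho) => x ax; rewrite bump_support// mul0r.
Qed.

End SwirlProfile.

(** * Test functions and integration by parts *)

Section TestFunctions.
Context {R : realType}.

Section OnV.
Context {V : normedModType R}.

Lemma smooth_C1 (f : V -> R) v : smooth f -> C1 v f ('D_v f).
Proof.
move=> sf; have [cf df] := sf [::]; have [cdf _] := sf [:: v].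
by split => // x; apply: derivableP; exact: df.
Qed.

(** Appending v at the end of the list of directions differentiates along v first. *)
Lemma smooth_derive (f : V -> R) v : smooth f -> smooth ('D_v f).
Proof.
move=> sf vs; have := sf (rcons vs v).
suff -> : Defs.iterD (rcons vs v) f = Defs.iterD vs ('D_v f) by [].
by elim: vs => //= w vs ->.
Qed.

Lemma supp_bounded (f : V -> R) : compact (supp f) -> exists a, forall x, a < `|x| -> f x = 0.
Proof.
move=> /compact_cube[a fa]; exists a => x ax; apply/eqP; apply: contraTT ax => fx.
by rewrite -leNgt; apply: fa; exact: subset_closure.
Qed.

Lemma test_C1c (U : set V) (f : V -> R) v : test_function U f -> C1c v f ('D_v f).
Proof. by move=> [sf cf _]; apply: C1_C1c (supp_bounded cf); exact: smooth_C1. Qed.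

Lemma test_C1c2 (U : set V) (f : V -> R) v w : test_function U f ->
  C1c v ('D_w f) ('D_v ('D_w f)).
Proof.
move=> tf; have [sf _ _] := tf; have [_ s] := C1c_C0c (test_C1c w tf).
by apply: C1_C1c s; apply: smooth_C1; exact: smooth_derive.
Qed.
End OnV.

Lemma is_derive_line0P (V : normedModType R) (f : V -> R) (x v : V) (df : R) :
  is_derive x v f df <-> is_derive (0 : R) (1 : R) (fun s : R => f (x + s *: v)) df.
Proof. by have := is_derive_lineP f x v 0 df; rewrite scale0r addr0. Qed.

Local Notation E := (R3 R).

Lemma C1c_slice (i : 'I_3) (phi phi' : R * E -> R) t : C1c (0, basis3 i) phi phi' ->
  C1c (basis3 i) (fun x => phi (t, x)) (fun x => phi' (t, x)).
Proof.
move=> [[cphi [a phi0]] cphi' dphi]; split; [split|..].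
- by move=> x; apply: (@continuous_comp _ _ _ (fun x : E => (t, x)) phi); [exact: continuous_pairr|exact: cphi].
- by exists a => x ax; apply: phi0; rewrite prod_normE/= lt_max ax orbT.
- by move=> x; apply: (@continuous_comp _ _ _ (fun x : E => (t, x)) phi'); [exact: continuous_pairr|exact: cphi'].
- move=> x; have /is_derive_line0P := dphi (t, x).
  rewrite (_ : (fun s => phi _) = (fun s : R => phi (t, x + s *: basis3 i))); last first.
    by apply/funext => s; congr (phi (_, _)); rewrite /= scaler0 addr0.
  by move=> H; apply/(is_derive_line0P (fun x : E => phi (t, x))).
Qed.

Lemma C1c_slice_time (phi phi' : R * E -> R) x : C1c ((1 : R), 0) phi phi' ->
  C1c (1 : R) (fun t => phi (t, x)) (fun t => phi' (t, x)).
Proof.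
move=> [[cphi [a phi0]] cphi' dphi]; split; [split|..].
- by move=> t; apply: (@continuous_comp _ _ _ (fun t : R => (t, x)) phi); [exact: continuous_pairl|exact: cphi].
- by exists a => t at_; apply: phi0; rewrite prod_normE/= lt_max at_.
- by move=> t; apply: (@continuous_comp _ _ _ (fun t : R => (t, x)) phi'); [exact: continuous_pairl|exact: cphi'].
- move=> t; have /is_derive_line0P := dphi (t, x).
  rewrite (_ : (fun s => phi _) = (fun s : R => phi (t + s *: (1 : R), x))); last first.
    by apply/funext => s; congr (phi (_, _)); rewrite /= scaler0 addr0.
  by move=> H; apply/(is_derive_line0P (fun t : R => phi (t, x))).
Qed.

Lemma integration_by_parts3 i (A A' g g' : E -> R) : C1c (basis3 i) A A' ->
  C1 (basis3 i) g g' -> \int[leb3]_x (A x * g' x) = - \int[leb3]_x (A' x * g x).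
Proof.
move=> hA hg; have [cg cg' _] := hg; have [cA _ _] := hA.
have i1 := C0c_integrable (C0c_mulr cA cg').
have i2 := C0c_integrable (C0c_mulr (C1c_C0c hA) cg).
apply/eqP; rewrite -subr_eq0 opprK addrC -(RintegralD measurableT i2 i1).
by rewrite /Rintegral (integral_C1c (C1c_mul hA hg)).
Qed.

End TestFunctions.

(** * Rotation-invariant functions *)

Section Radial.
Context {R : realType}.
Local Notation E := (R3 R).
Local Notation leb33 := (@leb3 R \x @leb3 R)%E.

Lemma newton_formD (A B1 B2 : E -> R) : C0c A -> C0c B1 -> C0c B2 ->
  newton_form A (fun x => B1 x + B2 x) = newton_form A B1 + newton_form A B2.
Proof.
move=> cA cB1 cB2.
rewrite /newton_form -(RintegralD measurableT (Psi_tensor_integrable cA cB1) (Psi_tensor_integrable cA cB2)).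
by apply: eq_Rintegral => z _; ring.
Qed.

Lemma newton_formZ (A B : E -> R) (k : R) : C0c A -> C0c B ->
  newton_form A (fun x => k * B x) = k * newton_form A B.
Proof.
move=> cA cB; rewrite /newton_form -(RintegralZl k measurableT (Psi_tensor_integrable cA cB)).
by apply: eq_Rintegral => z _; ring.
Qed.

Lemma newton_form0 (A : E -> R) : newton_form A (fun=> 0) = 0.
Proof.
rewrite /newton_form /Rintegral integral0_eq// => z _.
by rewrite mulr0 mulr0.
Qed.

Variable a : E.
Local Notation c := (rel_coord a).

(** The horizontal gradient is a multiple of (x, y), hence orthogonal to the rotation field
    (-y, x, 0): such functions are constant along the rotations about the axis through a. *)
Definition radial (g : E -> R) := exists K : E -> R,
  C1 (basis3 0) g (fun x => c 0 x * K x) /\ C1 (basis3 1) g (fun x => c 1 x * K x).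

Lemma radialM g h : radial g -> radial h -> radial (fun x => g x * h x).
Proof.
move=> [K [g0 g1]] [L [h0 h1]]; exists (fun x => K x * h x + g x * L x).
by split; [apply: C1_eq (C1_mul g0 h0) _ _|apply: C1_eq (C1_mul g1 h1) _ _] => x //; ring.
Qed.

Lemma radialD g h : radial g -> radial h -> radial (fun x => g x + h x).
Proof.
move=> [K [g0 g1]] [L [h0 h1]]; exists (fun x => K x + L x).
by split; [apply: C1_eq (C1_add g0 h0) _ _|apply: C1_eq (C1_add g1 h1) _ _] => x //; ring.
Qed.

Lemma radialZ (k : R) g : radial g -> radial (fun x => k * g x).
Proof.
move=> [K [g0 g1]]; exists (fun x => k * K x).
by split; [apply: C1_eq (C1_scale k g0) _ _|apply: C1_eq (C1_scale k g1) _ _] => x //; ring.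
Qed.

Definition axis_dist2 (x : E) : R := c 0 x ^+ 2 + c 1 x ^+ 2.

Lemma C1_axis_dist2 j : C1 (basis3 j) axis_dist2
  (fun x => 2 * ((0 == j)%:R * c 0 x + (1 == j)%:R * c 1 x)).
Proof.
apply: C1_eq (C1_add (C1_mul (C1_rel_coord a 0 j) (C1_rel_coord a 0 j)) (C1_mul (C1_rel_coord a 1 j) (C1_rel_coord a 1 j))) _ _ => x.
  by rewrite /axis_dist2 !expr2.
by ring.
Qed.

Lemma radial_axis_dist2 : radial axis_dist2.
Proof.
exists (fun=> 2); split; apply: C1_eq (C1_axis_dist2 _) _ _ => x //=.
  by rewrite mul1r mul0r addr0 mulrC.
by rewrite mul1r mul0r add0r mulrC.
Qed.

Lemma radial_bump rho k : radial (bump a rho k.+2).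
Proof.
exists (fun x => - 2 * k.+2%:R * bump a rho k.+1 x).
by split; apply: C1_eq (C1_bump a rho k _) _ _ => x //; ring.
Qed.

(** Multiplication by a rotation-invariant function commutes with the rotational derivative. *)
Lemma rotational_radial (psi psi0 psi1 g : E -> R) :
  C1c (basis3 0) psi psi0 -> C1c (basis3 1) psi psi1 -> radial g ->
  rotational a (fun x => psi x * g x) (fun x => g x * (c 0 x * psi1 x - c 1 x * psi0 x)).
Proof.
move=> h0 h1 [K [g0 g1]]; eexists; eexists; split.
- exact: C1c_mul h0 g0.
- exact: C1c_mul h1 g1.
- by move=> x /=; rewrite /rel_coord; ring.
Qed.

Lemma radial_rotational F : radial F -> C0c F -> rotational a F (fun=> 0).
Proof.
move=> [K [F0 F1]] [_ sF]; eexists; eexists; split.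
- exact: C1_C1c F0 sF.
- exact: C1_C1c F1 sF.
- by move=> x /=; rewrite /rel_coord; ring.
Qed.

End Radial.

(** * The swirl and its pressure *)

Section Swirl.
Context {R : realType}.
Local Notation E := (R3 R).
Variables (a : E) (rho : R).
Hypothesis rho0 : 0 < rho.
Local Notation c := (rel_coord a).
Local Notation B := (bump a rho).

(** The generator of the rotations, coordinate by coordinate. *)
Definition rotation (i : 'I_3) (x : E) : R := coord3 i (- c 1 x, c 0 x, 0).
Definition drotation (i j : 'I_3) : R := coord3 i (- (1 == j)%:R, (0 == j)%:R, 0).

(** The square of the cut-off makes the field C^1; its energy density then has the fourth power
    of the cut-off as a factor, and is C^2. *)
Definition swirl (x : E) : E := (- (B 2 x * c 1 x), B 2 x * c 0 x, 0).

Definition dswirl (i j : 'I_3) (x : E) : R :=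
  - 4 * c j x * B 1 x * rotation i x + B 2 x * drotation i j.

Lemma swirlE i x : coord3 i (swirl x) = B 2 x * rotation i x.
Proof.
by case: i => -[|[|[|//]]] ?; rewrite /swirl /rotation /coord3/= ?mulr0// mulrN.
Qed.

Lemma C1_rotation i j : C1 (basis3 j) (rotation i) (fun=> drotation i j).
Proof.
case: i => -[|[|[|//]]] i3; rewrite /rotation /drotation /coord3/=.
- by apply: C1_eq (C1_scale (-1) (C1_rel_coord a 1 j)) _ _ => x; rewrite mulN1r.
- exact: C1_rel_coord.
- exact: C1_const.
Qed.

Lemma C1c_swirl i j : C1c (basis3 j) (fun x => coord3 i (swirl x)) (dswirl i j).
Proof.
apply: C1c_eq (C1c_bump a rho0 0 (C1_rotation i j)) _ _ => x; first by rewrite swirlE.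
by rewrite /dswirl; ring.
Qed.

Lemma swirl_dot (w : 'I_3 -> R) x :
  \sum_i coord3 i (swirl x) * w i = B 2 x * (c 0 x * w 1 - c 1 x * w 0).
Proof.
rewrite sum3 !swirlE /rotation /coord3/=.
by ring.
Qed.

(** The integrand is the rotational derivative of the test function times a rotation-invariant
    factor. *)
Lemma swirl_divergence_free (k : R) : divergence_free (fun x => k *: swirl x).
Proof.
move=> psi tpsi; have h i := test_C1c (basis3 i) tpsi.
have H := rotational_radial (h 0) (h 1) (radial_bump a rho 0).
have -> : (fun x => \sum_i coord3 i (k *: swirl x) * partial i psi x) =
    (fun x => k * (B 2 x * (c 0 x * partial 1 psi x - c 1 x * partial 0 psi x))).
  apply/funext => x; rewrite -(swirl_dot (fun i => partial i psi x)) mulr_sumr.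
  by apply: eq_bigr => i _; rewrite coord3Z mulrA.
rewrite (RintegralZl k measurableT (C0c_integrable (rotational_C0c H))).
by rewrite /Rintegral (integral_rotational H) mulr0.
Qed.

Definition tensor (i j : 'I_3) (x : E) : R := B 4 x * (rotation i x * rotation j x).

Lemma tensorE i j x : coord3 i (swirl x) * coord3 j (swirl x) = tensor i j x.
Proof. by rewrite !swirlE /tensor /bump mulrACA pos_powM. Qed.

Definition horizontal (j : 'I_3) (x : E) : R := coord3 j (c 0 x, c 1 x, 0).
Definition dhorizontal (j i : 'I_3) : R := coord3 j ((0 == i)%:R, (1 == i)%:R, 0).

Lemma C1_horizontal j i : C1 (basis3 i) (horizontal j) (fun=> dhorizontal j i).
Proof.
case: j => -[|[|[|//]]] j3; rewrite /horizontal /dhorizontal /coord3/=.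
- exact: C1_rel_coord.
- exact: C1_rel_coord.
- exact: C1_const.
Qed.

Definition dtensor (i j k : 'I_3) (x : E) : R :=
  - 8 * c k x * B 3 x * (rotation i x * rotation j x) + B 4 x * (drotation i k * rotation j x + rotation i x * drotation j k).

Lemma C1c_tensor i j k : C1c (basis3 k) (tensor i j) (dtensor i j k).
Proof.
apply: C1c_eq (C1c_bump a rho0 2 (C1_mul (C1_rotation i k) (C1_rotation j k))) _ _ => x //.
by rewrite /dtensor; ring.
Qed.

(** The divergence of v (x) v is the acceleration of the swirl, which is centripetal. *)
Lemma div_tensor j x : \sum_i dtensor i j i x = - (B 4 x * horizontal j x).
Proof.
rewrite sum3 /dtensor /drotation /rotation /horizontal /coord3/=.
by case: j => -[|[|[|//]]] ? /=; ring.
Qed.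

(** The double divergence of v (x) v, written so that its rotation invariance is apparent. *)
Definition source (x : E) : R := 8 * (B 3 x * axis_dist2 a x) + - 2 * B 4 x.

Definition dcentripetal (j : 'I_3) (x : E) : R := - 8 * c j x * B 3 x * horizontal j x + B 4 x * dhorizontal j j.

Lemma C1c_centripetal j : C1c (basis3 j) (fun x => B 4 x * horizontal j x) (dcentripetal j).
Proof.
apply: C1c_eq (C1c_bump a rho0 2 (C1_horizontal j j)) _ _ => x //.
by rewrite /dcentripetal; ring.
Qed.

Lemma sourceE x : source x = - \sum_j dcentripetal j x.
Proof.
rewrite sum3 /dcentripetal /source /axis_dist2 /horizontal /dhorizontal /coord3/=.
by ring.
Qed.

Lemma C0c_source : C0c source.
Proof.
apply: C0c_add; apply: C0c_scale; first by apply: C0c_bump => //; case: (C1_axis_dist2 a 0).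
have := @C0c_bump _ a _ rho0 3 _ (@continuous_const _ E 1).
by rewrite (_ : (fun x => _ * 1) = B 4)//; apply/funext => x; rewrite mulr1.
Qed.

Lemma radial_source : radial a source.
Proof.
apply: radialD; last exact/radialZ/radial_bump.
by apply: radialZ; apply: radialM; [exact: radial_bump|exact: radial_axis_dist2].
Qed.

Definition pressure : E -> R := convolution Psi source.

End Swirl.

(** * Transport and dissipation identities for the swirl *)

Section SwirlIdentities.
Context {R : realType}.
Local Notation E := (R3 R).
Variables (a : E) (rho : R).
Hypothesis rho0 : 0 < rho.
Local Notation c := (rel_coord a).
Local Notation B := (bump a rho).
Local Notation swirl := (swirl a rho).
Local Notation pressure := (pressure a rho).

Lemma C0c_sum (I : Type) (r : seq I) (A : I -> E -> R) : (forall i, C0c (A i)) ->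
  C0c (fun x => \sum_(i <- r) A i x).
Proof.
move=> cA; elim: r => [|i r IH].
  rewrite (_ : (fun x => _) = fun=> 0); last by apply/funext => x; rewrite big_nil.
  by split; [exact: continuous_const|exists 0].
rewrite (_ : (fun x => _) = fun x => A i x + \sum_(i <- r) A i x); first exact: C0c_add.
by apply/funext => x; rewrite big_cons.
Qed.

Lemma newton_form_sum (I : Type) (r : seq I) (A : E -> R) (D : I -> E -> R) : C0c A ->
  (forall i, C0c (D i)) ->
  newton_form A (fun x => \sum_(i <- r) D i x) = \sum_(i <- r) newton_form A (D i).
Proof.
move=> cA cD; elim: r => [|i r IH].
  rewrite big_nil (_ : (fun x => _) = fun=> 0) ?newton_form0//.
  by apply/funext => x; rewrite big_nil.
rewrite big_cons -IH -newton_formD//; last exact: C0c_sum.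
by congr newton_form; apply/funext => x; rewrite big_cons.
Qed.

(** Both sides are values of [newton_form].  The double divergence in the source is moved, one
    derivative at a time, onto the test function. *)
Lemma pressure_swirl (k : R) psi : test_function setT psi ->
  \int[leb3]_x (k ^+ 2 * pressure x * psi x) =
  pressure_distribution (fun x => k *: swirl x) psi.
Proof.
move=> tpsi; have cpsi : C0c psi by case: (test_C1c 0 tpsi).
have hpsi i := test_C1c (basis3 i) tpsi.
have h2 i j := test_C1c2 (basis3 i) (basis3 j) tpsi.
have csrc := C0c_source a rho0.
have cT i j : C0c (tensor a rho i j) by case: (C1c_tensor a rho0 i j 0).
have cBr j : C0c (fun x => B 4 x * horizontal a j x) by case: (C1c_centripetal a rho0 j).
transitivity (k ^+ 2 * newton_form psi (source a rho)).
  rewrite -(integral_convolution cpsi csrc).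
  rewrite -(RintegralZl (k ^+ 2) measurableT); last first.
    have [C pC] := convolution_bounded csrc.
    exact: bounded_mul_C0c_integrable (measurable_convolution csrc) pC cpsi.
  by apply: eq_Rintegral => x _; rewrite mulrA.
have -> : source a rho = fun x => -1 * \sum_j dcentripetal a rho j x.
  by apply/funext => x; rewrite sourceE mulN1r.
have cdBr j : C0c (dcentripetal a rho j) := C1c_C0c (C1c_centripetal a rho0 j).
rewrite (newton_formZ _ cpsi (C0c_sum _ cdBr)) (newton_form_sum _ cpsi cdBr).
rewrite /pressure_distribution exchange_big/= mulrA mulr_sumr; apply: eq_bigr => j _.
have -> : newton_form psi (dcentripetal a rho j) = - newton_form ('D_(basis3 j) psi) (fun x => B 4 x * horizontal a j x).
  by rewrite (newton_form_partial (hpsi j) (C1c_centripetal a rho0 j)) opprK.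
have cdpsi : C0c ('D_(basis3 j) psi) := C1c_C0c (hpsi j).
have -> : newton_form ('D_(basis3 j) psi) (fun x => B 4 x * horizontal a j x) =
    - \sum_i newton_form ('D_(basis3 j) psi) (dtensor a rho i j i).
  have cdT i : C0c (dtensor a rho i j i) := C1c_C0c (C1c_tensor a rho0 i j i).
  rewrite -(newton_form_sum _ cdpsi cdT) -mulN1r -newton_formZ//; last exact: C0c_sum.
  by congr newton_form; apply/funext => x; rewrite div_tensor mulN1r opprK.
rewrite opprK mulrN1 mulNr mulr_sumr -sumrN; apply: eq_bigr => i _.
have -> : newton_form ('D_(basis3 j) psi) (dtensor a rho i j i) =
    - newton_form ('D_(basis3 i) ('D_(basis3 j) psi)) (tensor a rho i j).
  by rewrite (newton_form_partial (h2 i j) (C1c_tensor a rho0 i j i)) opprK.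
rewrite mulrN opprK -newton_formZ//; last exact: C1c_C0c (h2 i j).
rewrite -integral_convolution; [|exact: C1c_C0c (h2 i j)|exact: C0c_scale].
apply: eq_Rintegral => x _; congr (convolution Psi _ x * _).
by apply/funext => y; rewrite !coord3Z -tensorE; ring.
Qed.

Definition energy (x : E) : R := B 4 x * axis_dist2 a x.

Lemma enorm_swirl (k : R) x : enorm (k *: swirl x) ^+ 2 = k ^+ 2 * energy x.
Proof.
rewrite sqr_sqrtr; last by apply: sumr_ge0 => i _; exact: sqr_ge0.
have B4 : B 4 x = B 2 x ^+ 2 by rewrite expr2 /bump pos_powM.
by rewrite sum3 !coord3Z !swirlE /energy B4 /axis_dist2 /rotation /coord3/=; ring.
Qed.

Lemma C0c_energy : C0c energy.
Proof. by apply: C0c_bump => //; case: (C1_axis_dist2 a 0). Qed.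

Lemma energy_ge0 x : 0 <= energy x.
Proof. by rewrite mulr_ge0 ?pos_pow_nneg// addr_ge0 ?sqr_ge0. Qed.

(** The swirl transports a rotation-invariant g along its level sets. *)
Lemma swirl_transport g phi phi' :
  (forall i, C1c (basis3 i) phi (phi' i)) -> radial a g ->
  C0c (fun x => g x * \sum_i coord3 i (swirl x) * phi' i x) /\
  \int[leb3]_x (g x * \sum_i coord3 i (swirl x) * phi' i x) = 0.
Proof.
move=> h rg; have H := rotational_radial (h 0) (h 1) (radialM rg (radial_bump a rho 0)).
rewrite (_ : (fun x => _) = (fun x => g x * B 2 x * (c 0 x * phi' 1 x - c 1 x * phi' 0 x))).
  by split; [exact: rotational_C0c H|rewrite /Rintegral (integral_rotational H)].
by apply/funext => x; rewrite (swirl_dot a rho (fun i => phi' i x)) mulrA.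
Qed.

(** The pressure need not be differentiated: the integral is the value of [newton_form] at a
    rotational derivative and at the source, and by skewness the derivative moves to the
    rotation-invariant source, which it annihilates. *)
Lemma pressure_transport phi phi' : (forall i, C1c (basis3 i) phi (phi' i)) ->
  leb3.-integrable setT (EFin \o (fun x => pressure x * \sum_i coord3 i (swirl x) * phi' i x)) /\
  \int[leb3]_x (pressure x * \sum_i coord3 i (swirl x) * phi' i x) = 0.
Proof.
move=> h; have H := rotational_radial (h 0) (h 1) (radial_bump a rho 0).
have csrc := C0c_source a rho0.
rewrite (_ : (fun x => _) = (fun x => pressure x * (B 2 x * (c 0 x * phi' 1 x - c 1 x * phi' 0 x)))).
  split.
    have [C pC] := convolution_bounded csrc.
    exact: bounded_mul_C0c_integrable (measurable_convolution csrc) pC (rotational_C0c H).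
  rewrite (integral_convolution (rotational_C0c H) csrc).
  rewrite (newton_form_rotational H (radial_rotational (radial_source a rho) csrc)).
  by rewrite newton_form0 oppr0.
by apply/funext => x; rewrite (swirl_dot a rho (fun i => phi' i x)).
Qed.

Definition denergy (i : 'I_3) (x : E) : R :=
  - 8 * c i x * B 3 x * axis_dist2 a x + B 4 x * (2 * ((0 == i)%:R * c 0 x + (1 == i)%:R * c 1 x)).

Lemma C1c_energy i : C1c (basis3 i) energy (denergy i).
Proof.
apply: C1c_eq (C1c_bump a rho0 2 (C1_axis_dist2 a i)) _ _ => x //.
by rewrite /denergy; ring.
Qed.

Definition ddenergy (i : 'I_3) (x : E) : R :=
  (- 6 * c i x * B 2 x * (- 8 * c i x * axis_dist2 a x) +
   B 3 x * (- 8 * axis_dist2 a x - 16 * c i x * ((0 == i)%:R * c 0 x + (1 == i)%:R * c 1 x))) +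
  (- 8 * c i x * B 3 x * (2 * ((0 == i)%:R * c 0 x + (1 == i)%:R * c 1 x)) +
   B 4 x * (2 * ((0 == i)%:R + (1 == i)%:R))).

Lemma C1c_add v (A A' D D' : E -> R) : C1c v A A' -> C1c v D D' ->
  C1c v (fun x => A x + D x) (fun x => A' x + D' x).
Proof.
move=> [cA cA' dA] [cD cD' dD]; split; [exact: C0c_add|exact: continuous_add|].
by move=> x; exact: is_derive_add.
Qed.

Lemma C1c_denergy i : C1c (basis3 i) (denergy i) (ddenergy i).
Proof.
have H3 := C1c_bump a rho0 1 (C1_mul (C1_scale (- 8) (C1_rel_coord a i i)) (C1_axis_dist2 a i)).
have H4 := C1c_bump a rho0 2 (C1_scale 2 (C1_add (C1_scale (0 == i)%:R (C1_rel_coord a 0 i))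
  (C1_scale (1 == i)%:R (C1_rel_coord a 1 i)))).
apply: C1c_eq (C1c_add H3 H4) _ _ => x; first by rewrite /denergy; ring.
by case: i {H3 H4} => -[|[|[|//]]] i3; rewrite /ddenergy/=; ring.
Qed.

Lemma integral_energy_laplacian phi (phi1 phi2 : 'I_3 -> E -> R) :
  (forall i, C1c (basis3 i) phi (phi1 i)) -> (forall i, C1c (basis3 i) (phi1 i) (phi2 i)) ->
  \int[leb3]_x (energy x * \sum_i phi2 i x) = \int[leb3]_x (\sum_i ddenergy i x * phi x).
Proof.
move=> h1 h2.
have H i : \int[leb3]_x (energy x * phi2 i x) = \int[leb3]_x (ddenergy i x * phi x).
  rewrite (integration_by_parts3 (C1c_energy i) (C1c_C1 (h2 i))).
  by rewrite (integration_by_parts3 (C1c_denergy i) (C1c_C1 (h1 i))) opprK.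
have Rsum (D : 'I_3 -> E -> R) : (forall i, C0c (D i)) ->
    \int[leb3]_x (\sum_i D i x) = \sum_i \int[leb3]_x (D i x).
  move=> cD; rewrite sum3; under eq_Rintegral do rewrite sum3.
  rewrite (RintegralD measurableT (C0c_integrable (C0c_add (cD 0) (cD 1))) (C0c_integrable (cD 2))).
  by rewrite (RintegralD measurableT (C0c_integrable (cD 0)) (C0c_integrable (cD 1))).
under eq_Rintegral do rewrite mulr_sumr.
have cphi : continuous phi by case: (h1 0) => -[].
rewrite !Rsum; [by apply: eq_bigr|..].
- by move=> i; apply: C0c_mulr cphi; exact: C1c_C0c (C1c_denergy i).
- by move=> i; apply: C0c_mulr C0c_energy _; case: (h2 i).
Qed.

(** Any numerator that is at least 49 / 2 would do in [swirl_dissipation]: there the quadratic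
    2 u^2 - 56 u + 16 C rho^2 in u = C d has to be nonnegative, C being this rate. *)
Definition dissipation_rate : R := 25 / rho ^+ 2.

(** With d the depth and s the squared distance to the axis, Delta |v|^2 - 2 |grad v|^2 is
    s d^2 (16 rho^2 - 56 d) inside the ball, and |v|^2 is s d^4.  The first expression is
    negative only where d is comparable to rho^2, and there |v|^2 compensates. *)
Lemma swirl_dissipation x :
  0 <= \sum_i ddenergy i x - 2 * \sum_i \sum_j dswirl a rho i j x ^+ 2 + 2 * dissipation_rate * energy x.
Proof.
rewrite !sum3 /ddenergy /dswirl /energy /drotation /rotation /coord3/=.
have dE : depth a rho x = rho ^+ 2 - (c 0 x ^+ 2 + c 1 x ^+ 2 + c 2 x ^+ 2).
  by rewrite /depth /sqnorm sum3.
rewrite /bump; set d := depth a rho x in dE *.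
have [d0|d0] := leP d 0.
  by rewrite !pos_pow_le0// !(mulr0, mul0r, addr0, add0r, expr0n, subr0)/=.
rewrite !pos_pow_ge0 ?(ltW d0)// /axis_dist2.
set x0 := c 0 x in dE *; set x1 := c 1 x in dE *; set x2 := c 2 x in dE *.
set r := dissipation_rate.
have rE : r * rho ^+ 2 = 25 by rewrite /r /dissipation_rate; field; rewrite gt_eqF.
have r0 : 0 < r by rewrite divr_gt0// exprn_gt0.
have rho2 : rho ^+ 2 = d + x0 ^+ 2 + x1 ^+ 2 + x2 ^+ 2 by rewrite dE; ring.
rewrite [leRHS](_ : _ = (x0 ^+ 2 + x1 ^+ 2) * d ^+ 2 *
  (16 * (d + x0 ^+ 2 + x1 ^+ 2 + x2 ^+ 2) - 56 * d + 2 * r * d ^+ 2)); last by ring.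
rewrite -rho2; clearbody d; apply: mulr_ge0; first by rewrite mulr_ge0 ?addr_ge0 ?sqr_ge0.
(* Since r * rho ^+ 2 = 25, multiplying by r gives a quadratic in r * d without
   real roots. *)
rewrite -(pmulr_rge0 _ r0).
have -> : r * (16 * rho ^+ 2 - 56 * d + 2 * r * d ^+ 2) = 16 * (r * rho ^+ 2) - 56 * (r * d) + 2 * (r * d) ^+ 2 by ring.
rewrite rE (_ : _ + _ = 2 * (r * d - 14) ^+ 2 + 8); last by ring.
by rewrite addr_ge0// mulr_ge0// sqr_ge0.
Qed.

End SwirlIdentities.

(** * Monotone weights in time *)

Section MonotoneWeight.
Context {R : realType}.
Local Notation leb := (@lebesgue_measure R).

Definition down_closed (J : set R) := forall s t, s <= t -> J t -> J s.

Lemma down_closedP (J : set R) : down_closed J ->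
  [\/ J = set0, J = setT | exists b c, J = [set` Interval -oo%O (BSide b c)]].
Proof.
move=> dJ; have [->|/set0P J0] := eqVneq J set0; first exact: Or31.
have [JT|/existsNP[t0 t0J]] := pselect (forall t, J t).
  by apply: Or32; apply/seteqP; split.
have uJ : ubound J t0.
  by move=> t Jt; rewrite leNgt; apply/negP => /ltW tt0; apply: t0J; exact: dJ tt0 Jt.
have hs : has_sup J by split => //; exists t0.
have below t : t < sup J -> J t.
  by move=> /(sup_gt J0)[s Js /ltW ts]; exact: dJ ts Js.
have above t : J t -> t <= sup J by move=> Jt; exact: (sup_upper_bound hs).
apply: Or33; have [Jc|Jc] := pselect (J (sup J)).
- exists false, (sup J); apply/seteqP; split => t /=; rewrite in_itv/=; first exact: above.
  by move=> tc; exact: dJ tc Jc.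
- exists true, (sup J); apply/seteqP; split => t /=; rewrite in_itv/=; last exact: below.
  move=> Jt; rewrite lt_neqAle above// andbT; apply/negP => /eqP tc.
  by apply: Jc; rewrite -tc.
Qed.

(** On a half-line ending at c the integral is G c, and on the whole line it is zero. *)
Lemma down_closed_integral_ge0 (J : set R) (G G' : R -> R) : down_closed J ->
  C1c (1 : R) G G' -> (forall t, 0 <= G t) ->
  (0 <= \int[leb]_(t in J) (G' t)%:E)%E.
Proof.
move=> /down_closedP dJ hG G0; have [[cG [a Ga]] cG' dG] := hG.
have iG' := C0c_integrable1 (C1c_C0c hG).
have Gd t : is_derive t (1 : R) G (G' t) by exact: dG.
case: dJ => [->|->|[b [c ->]]].
- by rewrite integral_set0.
- by rewrite (integral_derivative_eq0 cG' Gd Ga).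
have -> : (\int[leb]_(t in [set` Interval -oo%O (BSide b c)]) (G' t)%:E =
    \int[leb]_(t in `]-oo, c]) (G' t)%:E)%E.
  case: b => //; rewrite integral_itv_bndo_bndc//.
  by apply: measurable_funS (measurable_int _ iG').
(* A point to the left of c and of the support of G. *)
pose d : R := - (`|a| + `|c| + 1).
have dc : d <= c.
  by rewrite /d lerNl (le_trans (ler_norm (- c)))// normrN; have := normr_ge0 a; lra.
have -> : (\int[leb]_(t in `]-oo, c]) (G' t)%:E = \int[leb]_(t in `[d, c]) (G' t)%:E)%E.
  rewrite integral_mkcond [RHS]integral_mkcond; apply: eq_integral => t _.
  rewrite !patchE !mem_setE !in_itv/=; case: (leP d t) => //= td; case: ifP => // _.
  congr EFin; apply: derivative_eq0 Ga _ (dG t).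
  rewrite (le_lt_trans (ler_norm a))// ltr_normr; apply/orP; right.
  by move: td; rewrite /d; have := normr_ge0 c; lra.
rewrite (FTC2_closed dc cG' Gd) (Ga d) ?subr0 ?lee_fin//.
rewrite /d normrN ger0_norm; last by rewrite !addr_ge0.
by rewrite (le_lt_trans (ler_norm a))//; have := normr_ge0 c; lra.
Qed.

(** Layer-cake: m t is the length of the set of levels s in ]0, m t], so that the integral is an
    integral over s of integrals of G' over the sets where s <= m, and these are half-lines
    because m is nonincreasing. *)
Lemma nonincreasing_weight_ge0 (m G G' : R -> R) (M : R) :
  (forall s t, s <= t -> m t <= m s) -> (forall t, 0 <= m t <= M) ->
  C1c (1 : R) G G' -> (forall t, 0 <= G t) ->
  (0 <= \int[leb]_t (m t * G' t)%:E)%E.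
Proof.
move=> dm mM hG G0; have cG' := C1c_C0c hG.
have M0 : 0 <= M by have /andP[m0] := mM 0; exact: le_trans.
have mm : measurable_fun setT m by apply: nonincreasing_measurable => // s t; exact: dm.
(* The region below the graph of m. *)
pose A : set (R * R) := [set z | 0 < z.2 /\ z.2 <= m z.1].
have mA : measurable A.
  rewrite (_ : A = (setT `&` snd @^-1` `]0, +oo[) `&`
      (setT `&` (fun z : R * R => m z.1 - z.2) @^-1` `[0, +oo[)).
    apply: measurableI; last first.
      have mms : measurable_fun setT (fun z : R * R => m z.1 - z.2).
        by apply: measurable_funB => //; exact: measurableT_comp.
      by apply: mms => //; exact: measurable_itv.
    by apply: (@measurable_snd _ _ _ _) => //; exact: measurable_itv.
  by apply/seteqP; split => -[t s]; rewrite /A/= !in_itv/= !andbT subr_ge0; [move=> [-> ->]|move=> [[_ ->] [_ ->]]].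
pose H (z : R * R) : R := \1_A z * G' z.1.
have mH : measurable_fun setT H.
  apply: measurable_funM; first exact: measurable_indic.
  apply: measurableT_comp => //; exact: continuous_measurable_fun (proj1 cG').
have [K GK] := C0c_bounded (@proper_norm_real R) cG'.
have [a Ga] := C0c_support cG'.
have iH : (leb \x leb)%E.-integrable setT (EFin \o H).
  apply: (@bounded_support_integrable _ _ _ leb2 _ _ K (measurable_cube2 (Num.max a M)) (cube2_fin (Num.max a M)) mH).
    move=> z; rewrite /H normrM indicE; apply: le_trans (GK z.1).
    by case: (_ \in _); rewrite ?normr1 ?mul1r// normr0 mul0r.
  move=> [t s] ts; rewrite /H indicE; case: (boolP (_ \in _)) => [|_]; last by rewrite mul0r.
  rewrite inE /A/= => -[s0 sm]; rewrite mul1r Ga// => ta; apply: ts.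
  move: ta; rewrite /cube/= prod_normE/= ge_max => ta; rewrite !le_max ta/=.
  apply/orP; right; have -> : `|s : R| = s by exact: gtr0_norm.
  by apply: le_trans sm _; case/andP: (mM t).
have lc (t : R) : (\int[leb]_s (\1_(`]0%R, m t]%classic : set R) s)%:E = (m t)%:E)%E.
  rewrite (integral_indic leb measurableT (measurable_itv _)) setIT.
  apply: etrans (lebesgue_measure_itv _) _; rewrite /= lte_fin.
  have /andP[] := mM t; rewrite le_eqVlt => /predU1P[<-|mt] _; first by rewrite ltxx.
  by rewrite mt -EFinB subr0.
have -> : (\int[leb]_t (m t * G' t)%:E = \int[leb]_t \int[leb]_s (EFin \o H) (t, s))%E.
  apply: eq_integral => t _; rewrite /H/=.
  transitivity (\int[leb]_s ((G' t)%:E * (\1_(`]0%R, m t]%classic : set R) s)%:E))%E.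
    rewrite integralZl//; last exact: integrable_indic_itv.
    by rewrite lc -EFinM mulrC.
  apply: eq_integral => s _; rewrite -EFinM mulrC !indicE.
  suff -> : (s \in (`]0%R, m t]%classic : set R)) = ((t, s) \in A) by [].
  by apply/idP/idP; rewrite !inE/= in_itv/=; [move=> /andP|move=> [-> ->]].
rewrite (Fubini iH); apply: integral_ge0 => s _.
have [s0|s0] := ltP 0 s; last first.
  rewrite integral0_eq// => t _; rewrite /H/= indicE memNset ?mul0r// /A/= => -[].
  by rewrite ltNge s0.
have dJ : down_closed [set t | s <= m t] by move=> t t' tt' /= st'; exact: le_trans st' (dm _ _ tt').
have := down_closed_integral_ge0 dJ hG G0; rewrite integral_mkcond.
congr (_ <= _)%E; apply: eq_integral => t _; rewrite patchE /H/= indicE.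
case: ifPn; rewrite ?inE ?notin_setE => st.
  by rewrite mem_set ?mul1r.
by rewrite memNset ?mul0r// => -[_].
Qed.
End MonotoneWeight.

(** * Integration over space-time *)

Section SpaceTime.
Context {R : realType}.
Local Notation E := (R3 R).
Local Notation leb := (@lebesgue_measure R).

Lemma notin_supp_derive (V : normedModType R) (f : V -> R) v x :
  ~ supp f x -> f x = 0 /\ 'D_v f x = 0.
Proof.
move=> fx; have near0 : \near x, f x = 0.
  have : nbhs x (~` supp f).
    by apply: open_nbhs_nbhs; split => //; apply: closed_openC; exact: closed_closure.
  apply: filterS => y fy; apply/eqP; apply: contrapT => /negP fy0.
  by apply: fy; exact: subset_closure.
split; first exact: nbhs_singleton near0.
rewrite (near_eq_derive v (g := fun=> 0))//.
by rewrite (@derive_val _ _ _ _ _ _ _ (is_derive_const x v 0)).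
Qed.

Lemma EFin_Rintegral d (T : measurableType d) (mu : {measure set T -> \bar R}) (D : set T)
    (f : T -> R) : measurable D -> mu.-integrable D (EFin \o f) ->
  (\int[mu]_(x in D) (f x)%:E)%E = (\int[mu]_(x in D) f x)%:E.
Proof. by move=> mD fi; rewrite /Rintegral fineK//; exact: integrable_fin_num fi. Qed.

Lemma weight_integrable (k : R -> R) (C : R) (psi : R * E -> R) :
  measurable_fun setT k -> (forall t, `|k t| <= C) -> C0c psi ->
  (leb \x leb3)%E.-integrable setT (EFin \o (fun z => k z.1 * psi z)).
Proof.
move=> mk kC cpsi; have [M psiM] := C0c_bounded (@proper_norm_RR3 R) cpsi.
have [a psia] := C0c_support cpsi.
apply: (@bounded_support_integrable _ _ _ (leb \x leb3)%E _ _ (C * M) (measurable_cube13 a) (cube13_fin a)).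
- apply: measurable_funM; first exact: measurableT_comp.
  exact: continuous_measurable_RR3 (proj1 cpsi).
- by move=> z; rewrite normrM ler_pM.
- by move=> z za; rewrite psia// mulr0.
Qed.

Lemma integral_positive_times (F : R -> \bar R) : (forall t, t <= 0 -> F t = 0%E) ->
  (\int[leb]_(t in `]0%R, +oo[) F t = \int[leb]_t F t)%E.
Proof.
move=> F0; rewrite integral_mkcond; apply: eq_integral => t _; rewrite patchE.
case: ifPn => //; rewrite notin_setE/= in_itv/= andbT => /negP; rewrite -leNgt => t0.
by rewrite F0.
Qed.

Section partial_integral.
Variables (k : R -> R) (C : R) (psi : R * E -> R).
Hypotheses (mk : measurable_fun setT k) (kC : forall t, `|k t| <= C) (cpsi : C0c psi).

Lemma C0c_slice t : C0c (fun x => psi (t, x)).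
Proof.
have [cp [b pb]] := cpsi; split.
  by move=> x; apply: (@continuous_comp _ _ _ (fun x : E => (t, x)) psi); [exact: continuous_pairr|exact: cp].
by exists b => x bx; apply: pb; rewrite prod_normE/= lt_max bx orbT.
Qed.

Lemma slice_integrable (c : R) t : leb3.-integrable setT (EFin \o (fun x => c * psi (t, x))).
Proof. exact: C0c_integrable (C0c_scale c (C0c_slice t)). Qed.

Lemma partial_integral_integrable :
  leb.-integrable setT (EFin \o (fun t => \int[leb3]_x (k t * psi (t, x)))).
Proof.
have := integrable_fubini_F (weight_integrable mk kC cpsi).
apply: eq_integrable => // t _; rewrite /fubini_F/=.
exact: EFin_Rintegral (slice_integrable (k t) t).
Qed.

End partial_integral.

End SpaceTime.

(** * The local energy inequality for the decaying swirl *)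

Section DecayingSwirl.
Context {R : realType}.
Local Notation E := (R3 R).
Local Notation leb := (@lebesgue_measure R).
Variables (a : E) (rho : R) (lam : R) (w : R -> R) (W : R).
Hypotheses (rho0 : 0 < rho) (lam0 : 0 <= lam).
Hypothesis w_nincr : forall s t, s <= t -> w t <= w s.
Hypothesis w_bounded : forall t, 0 <= w t <= W.

(** The exponent is frozen for negative times, which keeps the amplitude bounded; test functions
    only see positive times. *)
Definition amplitude (t : R) : R := expR (- (lam * Num.max 0 t)) * w t.

Local Notation eta := amplitude.
Local Notation swirl := (swirl a rho).
Local Notation pressure := (pressure a rho).
Local Notation energy := (energy a rho).
Local Notation dswirl := (dswirl a rho).
Local Notation ddenergy := (ddenergy a rho).

Definition decaying_swirl (t : R) (x : E) : E := eta t *: swirl x.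
Definition decaying_gradient (i j : 'I_3) (t : R) (x : E) : R := eta t * dswirl i j x.
Definition decaying_pressure (t : R) (x : E) : R := eta t ^+ 2 * pressure x.

Lemma measurable_w : measurable_fun setT w.
Proof. by apply: nonincreasing_measurable => // s t; exact: w_nincr. Qed.

Lemma amplitude_bounded t : 0 <= eta t <= W.
Proof.
have /andP[w0 wW] := w_bounded t; rewrite mulr_ge0 ?expR_ge0//=.
apply: le_trans wW; rewrite ler_piMl// expR_le1 oppr_le0 mulr_ge0// le_max lexx//.
Qed.

Lemma amplitude_nincr s t : s <= t -> eta t <= eta s.
Proof.
move=> st; apply: ler_pM; rewrite ?expR_ge0 ?w_nincr//; first by case/andP: (w_bounded t).
by rewrite ler_expR lerN2 ler_wpM2l// ge_max !le_max lexx st orbT.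
Qed.

Lemma measurable_amplitude : measurable_fun setT eta.
Proof. by apply: nonincreasing_measurable => // s t; exact: amplitude_nincr. Qed.

Lemma measurable_amplitude2 : measurable_fun setT (fun t => eta t ^+ 2).
Proof. by apply: measurable_funX; exact: measurable_amplitude. Qed.

Lemma amplitude2_bounded t : `|eta t ^+ 2| <= W ^+ 2.
Proof.
have /andP[e0 eW] := amplitude_bounded t.
by rewrite ger0_norm ?sqr_ge0// ler_sqr// nnegrE// (le_trans e0).
Qed.

Variables (phi : R * E -> R).
Hypothesis tphi : test_function positive_times phi.
Hypothesis phi0 : forall z, 0 <= phi z.

Local Notation hphi i := (test_C1c (0, basis3 i) tphi).

Lemma C0c_phi : C0c phi.
Proof. by case: (hphi 0). Qed.

Lemma slice1 t i : C1c (basis3 i) (fun x => phi (t, x)) (fun x => dx i phi (t, x)).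
Proof. exact: C1c_slice (hphi i). Qed.

Lemma slice2 t i : C1c (basis3 i) (fun x => dx i phi (t, x)) (fun x => dx i (dx i phi) (t, x)).
Proof. exact: C1c_slice (test_C1c2 _ _ tphi). Qed.

Lemma C0c_dt : C0c (dt phi).
Proof. exact: C1c_C0c (test_C1c _ tphi). Qed.

Lemma vanish_nonpositive t x : t <= 0 -> phi (t, x) = 0 /\ dt phi (t, x) = 0.
Proof.
move=> t0; apply: notin_supp_derive => tx; case: tphi => _ _ /(_ _ tx).
by rewrite /positive_times/= ltNge t0.
Qed.

Lemma C0c_mul_space (g : E -> R) (psi : R * E -> R) : continuous g -> C0c psi ->
  C0c (fun z => g z.2 * psi z).
Proof.
move=> cg cpsi; have := C0c_mulr cpsi (_ : continuous (fun z : R * E => g z.2)).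
rewrite (_ : (fun x => psi x * g x.2) = (fun z => g z.2 * psi z)); last first.
  by apply/funext => z; rewrite mulrC.
apply=> z; apply: (@continuous_comp _ _ _ snd g); [exact: cvg_snd|exact: cg].
Qed.

Definition dissipation (x : E) : R := \sum_i \sum_j dswirl i j x ^+ 2.
Definition laplacian_energy (x : E) : R := \sum_i ddenergy i x.

Lemma continuous_energy : continuous energy.
Proof. by case: (C0c_energy a rho0). Qed.

Lemma C0c_dissipation : C0c dissipation.
Proof.
apply: C0c_sum => i; apply: C0c_sum => j.
have [_ cd _] := C1c_swirl a rho0 i j.
have := C0c_mulr (C1c_C0c (C1c_swirl a rho0 i j)) cd.
by rewrite (_ : (fun x => _ * _) = (fun x => dswirl i j x ^+ 2))//; apply/funext => x; rewrite expr2.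
Qed.

Lemma C0c_laplacian_energy : C0c laplacian_energy.
Proof. by apply: C0c_sum => i; exact: C1c_C0c (C1c_denergy a rho0 i). Qed.

Definition gradient_density (z : R * E) : R := dissipation z.2 * phi z.
Definition time_density (z : R * E) : R := energy z.2 * dt phi z.
Definition laplacian_density (z : R * E) : R := laplacian_energy z.2 * phi z.
Definition mass_density (z : R * E) : R := energy z.2 * phi z.

Lemma C0c_gradient_density : C0c gradient_density.
Proof. exact: C0c_mul_space (proj1 C0c_dissipation) C0c_phi. Qed.
Lemma C0c_time_density : C0c time_density.
Proof. exact: C0c_mul_space continuous_energy C0c_dt. Qed.
Lemma C0c_laplacian_density : C0c laplacian_density.
Proof. exact: C0c_mul_space (proj1 C0c_laplacian_energy) C0c_phi. Qed.

Lemma inner_dissipation t :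
  (\int[leb3]_x ((\sum_i \sum_j decaying_gradient i j t x ^+ 2) * phi (t, x))%:E)%E =
  (\int[leb3]_x (eta t ^+ 2 * gradient_density (t, x)))%:E.
Proof.
rewrite -EFin_Rintegral//; last exact: (slice_integrable C0c_gradient_density (eta t ^+ 2) t).
apply: eq_integral => x _; congr EFin.
rewrite /gradient_density/= mulrA; congr (_ * _); rewrite mulr_sumr; apply: eq_bigr => i _.
by rewrite mulr_sumr; apply: eq_bigr => j _; rewrite exprMn.
Qed.

(** The flux term disappears by the two transport identities, and two integrations by parts move
    the Laplacian from the test function to the energy density. *)
Lemma inner_flux nu t :
  (\int[leb3]_x (enorm (decaying_swirl t x) ^+ 2 * (dt phi (t, x) + nu * laplacian phi (t, x))
     + (enorm (decaying_swirl t x) ^+ 2 + 2 * decaying_pressure t x)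
       * \sum_i coord3 i (decaying_swirl t x) * dx i phi (t, x))%:E)%E =
  (\int[leb3]_x (eta t ^+ 2 * time_density (t, x)) + nu * \int[leb3]_x (eta t ^+ 2 * laplacian_density (t, x)))%:E.
Proof.
set k := eta t.
have [cET ET] := swirl_transport rho (slice1 t) (radialM (radial_bump a rho 2) (radial_axis_dist2 a)).
have [iPT PT] := pressure_transport a rho0 (slice1 t).
have i1 := slice_integrable C0c_time_density (k ^+ 2) t.
pose lap x := \sum_i dx i (dx i phi) (t, x).
have clap : C0c (fun x => energy x * lap x).
  apply: C0c_mulr; first exact: C0c_energy.
  suff [] : C0c lap by [].
  by apply: C0c_sum => i; exact: C1c_C0c (slice2 t i).
have -> : \int[leb3]_x (k ^+ 2 * laplacian_density (t, x)) = k ^+ 2 * \int[leb3]_x (energy x * lap x).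
  rewrite (RintegralZl _ measurableT (C0c_integrable (C0c_slice C0c_laplacian_density t))); congr (_ * _).
  rewrite (integral_energy_laplacian a rho0 (slice1 t) (slice2 t)).
  by apply: eq_Rintegral => x _; rewrite /laplacian_density/= mulr_suml.
transitivity (\int[leb3]_x ((k ^+ 2 * time_density (t, x) + (nu * k ^+ 2) * (energy x * lap x)) +
   (k ^+ 3 * (energy x * \sum_i coord3 i (swirl x) * dx i phi (t, x)) +
    (2 * k ^+ 3) * (pressure x * \sum_i coord3 i (swirl x) * dx i phi (t, x))))%:E)%E.
  apply: eq_integral => x _; congr EFin.
  rewrite !enorm_swirl /decaying_pressure -/k /time_density/= /laplacian -/(lap x).
  have -> : \sum_i coord3 i (decaying_swirl t x) * dx i phi (t, x) =
      k * \sum_i coord3 i (swirl x) * dx i phi (t, x).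
    by rewrite mulr_sumr; apply: eq_bigr => i _; rewrite coord3Z -/k mulrA.
  by ring.
have i2 := C0c_integrable (C0c_scale (nu * k ^+ 2) clap).
have i3 := C0c_integrable (C0c_scale (k ^+ 3) cET).
have i4 : leb3.-integrable setT (EFin \o (fun x => (2 * k ^+ 3) *
    (pressure x * \sum_i coord3 i (swirl x) * dx i phi (t, x)))).
  exact: (integrableZl measurableT (2 * k ^+ 3) iPT).
have i12 := integrableD measurableT i1 i2.
have i34 := integrableD measurableT i3 i4.
rewrite (EFin_Rintegral measurableT (integrableD measurableT i12 i34)); congr EFin.
rewrite (RintegralD measurableT i12 i34) (RintegralD measurableT i1 i2) (RintegralD measurableT i3 i4).
rewrite (RintegralZl _ measurableT (C0c_integrable clap)) (RintegralZl _ measurableT (C0c_integrable cET)).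
by rewrite (RintegralZl _ measurableT iPT) ET PT !mulr0 !addr0 mulrA.
Qed.

(** The time derivative of energy * exp (-2 lam t) * phi: the smooth part of the squared amplitude
    is differentiated together with the test function, the weight w^2 is left outside. *)
Definition decay_density (z : R * E) : R :=
  energy z.2 * (expR (- (2 * lam * z.1)) * (dt phi z - 2 * lam * phi z)).

Lemma C1c_decay x : C1c (1 : R) (fun t => energy x * (expR (- (2 * lam * t)) * phi (t, x)))
  (fun t => decay_density (t, x)).
Proof.
have hlin : C1 (1 : R) (fun t : R => - (2 * lam) * t) (fun=> - (2 * lam)).
  split.
  - by apply: continuous_mul; [exact: continuous_const|move=> t; exact: cvg_id].
  - exact: continuous_const.
  - by move=> t; apply: is_derive_eq (is_derive_scale (- (2 * lam)) (is_derive_id t (1 : R))) _; rewrite mulr1.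
have hexp : C1 (1 : R) (fun t : R => expR (- (2 * lam) * t))
    (fun t => expR (- (2 * lam) * t) * - (2 * lam)).
  by apply: (C1_chain (F := expR) (F' := expR) hlin) => t; exact: continuous_expR.
have htime := C1c_slice_time x (test_C1c ((1 : R), 0) tphi).
have hconst := C1_const (1 : R) (energy x).
apply: C1c_eq (C1c_mul (C1c_mul htime hexp) hconst) _ _ => t.
  by rewrite mulNr; ring.
by rewrite /decay_density /dt/= -(mulNr (2 * lam)); ring.
Qed.

Lemma C0c_decay_density : C0c decay_density.
Proof.
apply: C0c_mul_space; first exact: continuous_energy.
rewrite (_ : (fun z => _) = (fun z : R * E => (dt phi z - 2 * lam * phi z) * expR (- (2 * lam * z.1)))).
  apply: C0c_mulr; first by apply: C0c_sub; [exact: C0c_dt|exact: C0c_scale C0c_phi].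
  move=> z; apply: (@continuous_comp _ _ _ (fun z : R * E => - (2 * lam * z.1)) expR).
    by apply: cvgN; apply: cvgM; [exact: cvg_cst|exact: cvg_fst].
  exact: continuous_expR.
by apply/funext => z; rewrite mulrC.
Qed.

(** The weak time derivative of the squared amplitude, tested against phi, is at most
    - 2 lam times the squared amplitude.  This identity isolates the smooth part of that claim. *)
Lemma amplitude_decay t x : eta t ^+ 2 * (time_density (t, x) - 2 * lam * mass_density (t, x)) =
  w t ^+ 2 * decay_density (t, x).
Proof.
rewrite /time_density /mass_density /decay_density/=; have [t0|t0] := leP t 0.
  by have [-> ->] := vanish_nonpositive x t0; ring.
rewrite /amplitude max_r ?(ltW t0)//.
have -> : - (2 * lam * t) = - (lam * t) + - (lam * t) by ring.
by rewrite expRD; ring.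
Qed.

Lemma measurable_w2 : measurable_fun setT (fun t => w t ^+ 2).
Proof. by apply: measurable_funX; exact: measurable_w. Qed.

Lemma w2_bounded t : 0 <= w t ^+ 2 <= W ^+ 2.
Proof.
have /andP[w0 wW] := w_bounded t; rewrite sqr_ge0/= ler_sqr// nnegrE//.
exact: le_trans wW.
Qed.

(** For fixed x this is [nonincreasing_weight_ge0] with the weight w^2. *)
Lemma time_decay :
  (0 <= \int[leb]_t (\int[leb3]_x (w t ^+ 2 * decay_density (t, x)))%:E)%E.
Proof.
have wb t : `|w t ^+ 2| <= W ^+ 2.
  by have /andP[w0 wW] := w2_bounded t; rewrite ger0_norm.
have iw := weight_integrable measurable_w2 wb C0c_decay_density.
have -> : (\int[leb]_t (\int[leb3]_x (w t ^+ 2 * decay_density (t, x)))%:E =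
    \int[leb]_t \int[leb3]_x (w t ^+ 2 * decay_density (t, x))%:E)%E.
  apply: eq_integral => t _; rewrite EFin_Rintegral//.
  exact: (slice_integrable C0c_decay_density (w t ^+ 2) t).
rewrite (Fubini iw); apply: integral_ge0 => x _ /=.
apply: (nonincreasing_weight_ge0 (M := W ^+ 2) _ w2_bounded (C1c_decay x)) => [s t st|t].
  rewrite ler_sqr ?nnegrE ?w_nincr//.
    by case/andP: (w_bounded t).
  by case/andP: (w_bounded s).
apply: mulr_ge0; first exact: energy_ge0.
by apply: mulr_ge0; [exact: expR_ge0|exact: phi0].
Qed.

(** The viscous terms cost at most 2 nu C per unit of energy, and the exponential decay pays
    2 lam. *)
Lemma space_decay nu t : 0 <= nu -> nu * dissipation_rate rho <= lam ->
  \int[leb3]_x (w t ^+ 2 * decay_density (t, x)) <=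
  (\int[leb3]_x (eta t ^+ 2 * time_density (t, x)) + nu * \int[leb3]_x (eta t ^+ 2 * laplacian_density (t, x)))
  - 2 * nu * \int[leb3]_x (eta t ^+ 2 * gradient_density (t, x)).
Proof.
move=> nu0 nulam; set k := eta t ^+ 2.
have it := slice_integrable C0c_time_density k t.
have il := slice_integrable C0c_laplacian_density k t.
have id := slice_integrable C0c_gradient_density k t.
rewrite -(RintegralZl _ measurableT il) -(RintegralZl _ measurableT id).
have il' := integrableZl measurableT nu il.
have id' := integrableZl measurableT (2 * nu) id.
rewrite -(RintegralD measurableT it il') -(RintegralB measurableT (integrableD measurableT it il') id').
apply: le_Rintegral => //.
- exact: (slice_integrable C0c_decay_density (w t ^+ 2) t).
- exact: (integrableB measurableT (integrableD measurableT it il') id').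
- move=> x _; rewrite -amplitude_decay -/k -subr_ge0.
  have k0 : 0 <= k by exact: sqr_ge0.
  have := swirl_dissipation a rho0 x; rewrite -/(laplacian_energy x) -/(dissipation x) => H.
  rewrite /laplacian_density /gradient_density /mass_density/=.
  set h := energy x in H *; have h0 : 0 <= h by exact: energy_ge0.
  set L := laplacian_energy x in H *; set D := dissipation x in H *; set p := phi (t, x).
  have p0 : 0 <= p by exact: phi0.
  rewrite [leRHS](_ : _ = k * p * (nu * (L - 2 * D + 2 * dissipation_rate rho * h) + 2 * (lam - nu * dissipation_rate rho) * h)); last by ring.
  apply: mulr_ge0; first exact: mulr_ge0.
  apply: addr_ge0; first exact: mulr_ge0.
  by apply: mulr_ge0 => //; rewrite mulr_ge0// subr_ge0.
Qed.

(** The right-hand side minus the left-hand one is at least the integral of w^2 times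
    [decay_density], by [space_decay], and that integral is nonnegative by [time_decay]. *)
Lemma decaying_energy_inequality nu : 0 <= nu -> nu * dissipation_rate rho <= lam ->
  ((2 * nu)%:E * (\int[leb]_(t in `]0%R, +oo[) \int[leb3]_x
      ((\sum_i \sum_j decaying_gradient i j t x ^+ 2) * phi (t, x))%:E)
   <= \int[leb]_(t in `]0%R, +oo[) \int[leb3]_x
      (enorm (decaying_swirl t x) ^+ 2 * (dt phi (t, x) + nu * laplacian phi (t, x))
       + (enorm (decaying_swirl t x) ^+ 2 + 2 * decaying_pressure t x)
         * \sum_i coord3 i (decaying_swirl t x) * dx i phi (t, x))%:E)%E.
Proof.
move=> nu0 nulam.
under eq_integral do rewrite inner_dissipation.
under [in leRHS]eq_integral do rewrite inner_flux.
have mP : measurable (`]0, +oo[%classic : set (measurableTypeR R)) by exact: measurable_itv.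
have pi psi : C0c psi -> leb.-integrable `]0, +oo[ (EFin \o (fun t => \int[leb3]_x (eta t ^+ 2 * psi (t, x)))).
  move=> cpsi; apply: integrableS (partial_integral_integrable measurable_amplitude2 amplitude2_bounded cpsi) => //.
have id := pi _ C0c_gradient_density; have it := pi _ C0c_time_density; have il := pi _ C0c_laplacian_density.
have il' := integrableZl mP nu il; have itl := integrableD mP it il'.
have id' := integrableZl mP (2 * nu) id.
rewrite (EFin_Rintegral mP id) (EFin_Rintegral mP itl) -EFinM lee_fin -subr_ge0.
rewrite -(RintegralZl (2 * nu) mP id) -(RintegralB mP itl id').
have wb t : `|w t ^+ 2| <= W ^+ 2.
  by have /andP[? ?] := w2_bounded t; rewrite ger0_norm.
have iS := partial_integral_integrable measurable_w2 wb C0c_decay_density.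
apply: (@le_trans _ _ (\int[leb]_(t in `]0, +oo[) \int[leb3]_x (w t ^+ 2 * decay_density (t, x)))).
  rewrite /Rintegral fine_ge0//.
  rewrite (@integral_positive_times _ (fun t => (\int[leb3]_x (w t ^+ 2 * decay_density (t, x)))%:E)).
    exact: time_decay.
  move=> t t0; rewrite /Rintegral integral0_eq// => x _.
  by rewrite /decay_density/=; have [-> ->] := vanish_nonpositive x t0; rewrite mulr0 subr0 !mulr0.
apply: le_Rintegral => //.
- exact: integrableS iS.
- exact: (integrableB mP itl id').
- by move=> t _; exact: space_decay.
Qed.

End DecayingSwirl.

(** * The norm of the swirl *)

Section SwirlNorm.
Context {R : realType}.
Local Notation E := (R3 R).
Variables (a : E) (rho : R).
Hypothesis rho0 : 0 < rho.

Definition swirl_mass : R := \int[leb3]_x energy a rho x.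

(** The energy density is continuous and positive at the point a + (rho / 2, 0, 0), hence bounded
    below on a cube. *)
Lemma swirl_mass_gt0 : 0 < swirl_mass.
Proof.
have ie := C0c_integrable (C0c_energy a rho0).
pose x0 : E := a + (rho / 2) *: basis3 0.
have e0 : 0 < energy a rho x0.
  have cE i : rel_coord a i x0 = rho / 2 * (i == 0)%:R.
    by rewrite /rel_coord /x0 addrAC subrr add0r coord3Z coord3_basis3.
  have dE : depth a rho x0 = 3 / 4 * rho ^+ 2.
    by rewrite /depth /sqnorm sum3 -!/(rel_coord a _ x0) !cE /=; field.
  have r2 : 0 < rho ^+ 2 by rewrite exprn_gt0.
  rewrite /energy /bump dE pos_pow_ge0; last by rewrite mulr_ge0// ltW.
  rewrite mulr_gt0 ?exprn_gt0 ?mulr_gt0// /axis_dist2 !cE /= mulr1 mulr0 expr0n addr0.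
  by rewrite exprn_gt0// divr_gt0.
pose k := energy a rho x0 / 2; have k0 : 0 < k by rewrite divr_gt0.
have [d d0 dk] : exists2 d : R, 0 < d & forall x, `|x0 - x| <= d -> k <= energy a rho x.
  have /cvgrPdist_le/(_ _ k0)/nbhs_ballP[d /= d0 H] := @continuous_energy R a rho rho0 x0.
  exists (d / 2) => [|x xd]; first by rewrite divr_gt0.
  have : `|energy a rho x0 - energy a rho x| <= k.
    apply: H; rewrite -ball_normE/=; apply: le_lt_trans xd _.
    by rewrite ltr_pdivrMr// ltr_pMr// ltr1n.
  by rewrite ler_distlC => /andP[]; rewrite /k; lra.
rewrite -lte_fin /swirl_mass -(EFin_Rintegral measurableT ie).
apply: (@lt_le_trans _ _ (k%:E * leb3 (cube_at x0 d))%E).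
  by rewrite leb3_cube_at// -EFinM lte_fin mulr_gt0// exprn_gt0// mulr_gt0.
have mi : measurable_fun setT (\1_(cube_at x0 d) : E -> R).
  exact: (@measurable_indic _ _ R setT _ (measurable_cube_at x0 d)).
have mei : measurable_fun setT (fun y : E => (\1_(cube_at x0 d) y : R)%:E) by exact/measurable_EFinP.
have i0 (y : E) : setT y -> (0 <= (\1_(cube_at x0 d) y : R)%:E)%E by rewrite lee_fin.
have -> : (k%:E * leb3 (cube_at x0 d) = \int[leb3]_y (k%:E * (\1_(cube_at x0 d) y : R)%:E))%E.
  rewrite (ge0_integralZl_EFin leb3 measurableT i0 mei (ltW k0)).
  by rewrite (integral_indic leb3 measurableT (measurable_cube_at x0 d)) setIT.
apply: ge0_le_integral => //.
- by move=> y _; rewrite -EFinM lee_fin mulr_ge0// ltW.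
- by apply: measurable_funeM; exact: mei.
- exact: measurable_int ie.
- move=> y _; rewrite -EFinM lee_fin indicE.
  have [yx|yx] := pselect (cube_at x0 d y); last by rewrite memNset// mulr0 energy_ge0.
  by rewrite mem_set// mulr1; exact: dk.
Qed.

Lemma L2norm_swirl (k : R) : 0 <= k ->
  L2norm (fun x => k *: swirl a rho x) = (k * Num.sqrt swirl_mass)%:E.
Proof.
move=> k0; have ie := C0c_integrable (C0c_energy a rho0).
rewrite /L2norm unlock /=.
have -> : (\int[leb3]_x (`|(enorm (k *: swirl a rho x))%:E| `^ 2) = (k ^+ 2 * swirl_mass)%:E)%E.
  rewrite EFinM /swirl_mass -(EFin_Rintegral measurableT ie) -(integralZl measurableT ie).
  apply: eq_integral => x _; rewrite -EFinM -enorm_swirl /= powR_mulrn//.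
  by rewrite ger0_norm// sqrtr_ge0.
rewrite poweR12_sqrt; last by rewrite lee_fin mulr_ge0 ?sqr_ge0// ltW// swirl_mass_gt0.
by rewrite /= sqrtrM ?sqr_ge0// sqrtr_sqr ger0_norm.
Qed.

End SwirlNorm.

(** * The decaying swirl is a weak solution *)

Section DecayingSwirlNSI.
Context {R : realType}.
Local Notation E := (R3 R).
Local Notation leb := (@lebesgue_measure R).
Variables (a : E) (rho lam : R) (w : R -> R) (W T : R).
Hypotheses (rho0 : 0 < rho) (lam0 : 0 <= lam) (T0 : 0 < T).
Hypothesis w_nincr : forall s t, s <= t -> w t <= w s.
Hypothesis w_bounded : forall t, 0 <= w t <= W.
Hypothesis w_late : forall t, T < t -> w t = 0.

Local Notation u := (decaying_swirl a rho lam w).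
Local Notation g := (decaying_gradient a rho lam w).
Local Notation p := (decaying_pressure a rho lam w).
Local Notation eta := (amplitude lam w).

Let meta : measurable_fun setT eta := measurable_amplitude lam0 w_nincr w_bounded.
Let bounded_eta := amplitude_bounded lam0 w_bounded.

Lemma eta_norm t : `|eta t| <= W.
Proof. by have /andP[e0 eW] := bounded_eta t; rewrite ger0_norm. Qed.

Lemma measurable_weight_space (k : R -> R) (f : E -> R) : measurable_fun setT k ->
  measurable_fun setT f -> measurable_fun setT (fun z : R * E => k z.1 * f z.2).
Proof. by move=> mk mf; apply: measurable_funM; exact: measurableT_comp. Qed.

Lemma measurable_decaying_swirl : measurable_fun setT (fun z : R * E => u z.1 z.2).
Proof.
have mc i : measurable_fun setT (fun z : R * E => eta z.1 * coord3 i (swirl a rho z.2)).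
  have [[cv _] _ _] := C1c_swirl a rho0 i 0.
  exact: (measurable_weight_space meta (continuous_measurable_R3 cv)).
exact: (measurable_fun_pair (measurable_fun_pair (mc 0) (mc 1)) (mc 2)).
Qed.

Lemma measurable_decaying_gradient i j :
  measurable_fun setT (fun z : R * E => g i j z.1 z.2).
Proof.
have [_ cv _] := C1c_swirl a rho0 i j.
exact: (measurable_weight_space meta (continuous_measurable_R3 cv)).
Qed.

Lemma weak_gradient_decaying_swirl : weak_gradient u g.
Proof.
move=> i j phi tphi.
have hv := C1c_swirl a rho0 i j; have hphi := test_C1c (0, basis3 j) tphi.
have cphi : C0c phi by case: hphi.
have cg : C0c (fun z => dswirl a rho i j z.2 * phi z).
  by apply: C0c_mul_space cphi; case: hv.
have ig := partial_integral_integrable meta eta_norm cg.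
have mP : measurable (`]0, +oo[%classic : set (measurableTypeR R)) by exact: measurable_itv.
have igP : leb.-integrable `]0, +oo[ (EFin \o (fun t => \int[leb3]_x (g i j t x * phi (t, x)))).
  apply: eq_integrable (integrableS _ _ _ ig) => //= t _; congr EFin.
  by apply: eq_Rintegral => x _; rewrite /= mulrA.
rewrite -mulN1r -(RintegralZl (-1) mP igP); apply: eq_Rintegral => t _.
have hs := C1c_slice t hphi.
have cs : C0c (fun x => phi (t, x)) by case: hs.
have [cv cv' _] := hv.
transitivity (eta t * \int[leb3]_x (coord3 i (swirl a rho x) * dx j phi (t, x))).
  rewrite -(RintegralZl _ measurableT); last first.
    by apply: C0c_integrable; apply: C0c_mulr cv _; case: hs.
  by apply: eq_Rintegral => x _; rewrite coord3Z mulrA.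

rewrite (integration_by_parts3 hv (C1c_C1 hs)).
rewrite mulN1r mulrN -(RintegralZl _ measurableT); last first.
  exact: C0c_integrable (C0c_mulr (C1c_C0c hv) (proj1 cs)).
by congr (- _); apply: eq_Rintegral => x _; rewrite mulrA.
Qed.

Lemma is_pressure_decaying_swirl : is_pressure u p.
Proof.
have csrc := C0c_source a rho0; have mq := measurable_convolution csrc.
have [C qC] := convolution_bounded csrc.
split.
  apply: (@measurable_funS _ _ _ _ setT) => //.
  exact: (measurable_weight_space (measurable_amplitude2 lam0 w_nincr w_bounded) mq).
apply: aeW => t t0; split; last by move=> psi tpsi; exact: pressure_swirl.
apply: (@bounded_locally_integrable _ _ (W ^+ 2 * C)).
  by apply: measurable_funM => //; exact: measurable_cst.
move=> x; rewrite normrM; apply: ler_pM => //.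
  exact: (amplitude2_bounded lam0 w_bounded).
exact: qC.
Qed.

Lemma L2norm_decaying_swirl t :
  L2norm (u t) = (eta t * Num.sqrt (swirl_mass a rho))%:E.
Proof. by apply: L2norm_swirl => //; case/andP: (bounded_eta t). Qed.

(** The amplitude is bounded and vanishes after T. *)
Lemma gradient_square_integrable :
  (\int[leb]_(t in `]0%R, +oo[) \int[leb3]_x (\sum_i \sum_j g i j t x ^+ 2)%:E < +oo)%E.
Proof.
have cD := C0c_dissipation a rho0; have iD := C0c_integrable cD.
set K := \int[leb3]_x dissipation a rho x.
have K0 : 0 <= K.
  by apply: Rintegral_ge0 => x _; apply: sumr_ge0 => i _; apply: sumr_ge0 => j _; exact: sqr_ge0.
have inner t : (\int[leb3]_x (\sum_i \sum_j g i j t x ^+ 2)%:E = (eta t ^+ 2 * K)%:E)%E.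
  rewrite EFinM /K -(EFin_Rintegral measurableT iD) -(integralZl measurableT iD).
  apply: eq_integral => x _; rewrite -EFinM; congr EFin.
  rewrite mulr_sumr; apply: eq_bigr => i _; rewrite mulr_sumr; apply: eq_bigr => j _.
  by rewrite exprMn.
under eq_integral do rewrite inner.
have mP : measurable (`]0, +oo[%classic : set (measurableTypeR R)) by exact: measurable_itv.
have mK : measurable (`]0, T]%classic : set (measurableTypeR R)) by exact: measurable_itv.
apply: (@le_lt_trans _ _ (\int[leb]_(t in `]0%R, +oo[) ((W ^+ 2 * K)%:E * (\1_(`]0%R, T]%classic : set R) t)%:E))%E).
  apply: ge0_le_integral => //.
  - by move=> t _; rewrite lee_fin mulr_ge0// sqr_ge0.
  - apply/measurable_EFinP; apply: measurable_funS measurableT _ _ => //.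
    by apply: measurable_funM; [exact: measurable_funX|exact: measurable_cst].
  - apply: measurable_funeM; apply/measurable_EFinP; exact: measurable_indic.
  - move=> t /=; rewrite in_itv/= andbT => t0; rewrite -EFinM lee_fin indicE.
    have [tT|tT] := leP t T.
      rewrite mem_set/= ?in_itv/= ?t0// mulr1 ler_wpM2r//.
      by have := amplitude2_bounded lam0 w_bounded t; rewrite ger0_norm ?sqr_ge0.
    rewrite memNset/=; last by rewrite in_itv/= t0/= leNgt tT.
    by rewrite /amplitude w_late// mulr0 expr0n mul0r mulr0.
rewrite integralZl//; last first.
  by apply: integrableS (integrable_indic_itv 0 T false false) => //.
rewrite (integral_indic leb mP mK) -ge0_fin_numE; last by rewrite mule_ge0// lee_fin mulr_ge0// sqr_ge0.
rewrite fin_numM// ge0_fin_numE//.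
apply: (@le_lt_trans _ _ (leb (`]0%R, T]%classic : set R))).
  by apply: le_measure; rewrite ?inE//; exact: measurableI.
by rewrite lebesgue_measure_itv/= lte_fin T0 -EFinB ltry.
Qed.

Lemma weak_NSI_decaying_swirl nu : 0 <= nu -> nu * dissipation_rate rho <= lam -> weak_NSI nu u.
Proof.
move=> nu0 nulam; split.
- exact: measurable_funS measurable_decaying_swirl.
- by move=> t _; exact: swirl_divergence_free.
- apply: (@le_lt_trans _ _ (W * Num.sqrt (swirl_mass a rho))%:E); last exact: ltry.
  apply: ge_ereal_sup => _ [t _ <-].
  rewrite L2norm_decaying_swirl lee_fin ler_wpM2r ?sqrtr_ge0//.
  by case/andP: (bounded_eta t).
- exists g, p; split.
  + by move=> i j; exact: measurable_funS (measurable_decaying_gradient i j).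
  + exact: gradient_square_integrable.
  + exact: weak_gradient_decaying_swirl.
  + exact: is_pressure_decaying_swirl.
  + by move=> phi tphi phi0; exact: (decaying_energy_inequality a rho0 lam0 w_nincr w_bounded tphi phi0 nu0 nulam).
Qed.

(** The set where the depth is nonnegative is closed and contains the points where the field
    does not vanish. *)
Lemma supp_decaying_swirl t x : supp (u t) x -> sqnorm (x - a) <= rho ^+ 2.
Proof.
move=> ux.
have cl : closed [set y : E | 0 <= depth a rho y].
  apply: (@closed_comp _ _ (depth a rho) [set s | 0 <= s]); last exact: closed_ge.
  move=> y _; apply: cvgB; first exact: cvg_cst.
  by have [+ _ _] := C1_shift a (C1_sqnorm (0 : E)); exact.
suff : 0 <= depth a rho x by rewrite /depth subr_ge0.
apply: cl; apply: closure_subset ux => y /=; apply: contraNT; rewrite -ltNge => /ltW dy.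
rewrite /decaying_swirl /swirl /bump pos_pow_le0// !mul0r oppr0.
by rewrite (_ : ((0, 0, 0) : E) = 0)// scaler0.
Qed.

End DecayingSwirlNSI.

(** * The prescribed energy profile *)

Section Profile.
Context {R : realType}.
Variables (T : R) (e : R -> R).
Hypothesis T_gt0 : 0 < T.
Hypothesis e_ge0 : forall t, 0 <= t <= T -> 0 <= e t.
Hypothesis e_nincr : forall s t, 0 <= s -> s <= t -> t <= T -> e t <= e s.

(** Continued by e 0 before time 0 and by 0 after time T: both continuations keep the function
    nonincreasing, and the second one makes the solution vanish eventually. *)
Definition profile (t : R) : R := if t < 0 then e 0 else if t <= T then e t else 0.

Lemma profileE t : 0 <= t <= T -> profile t = e t.
Proof. by case/andP=> t0 tT; rewrite /profile ltNge t0 tT. Qed.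

Lemma profile_late t : T < t -> profile t = 0.
Proof.
by move=> Tt; rewrite /profile (ltNge t) (ltW (lt_trans T_gt0 Tt)) leNgt Tt.
Qed.

Let e0_ge0 : 0 <= e 0.
Proof. by apply: e_ge0; rewrite lexx ltW. Qed.

Lemma profile_bounded t : 0 <= profile t <= e 0.
Proof.
rewrite /profile; have [t0|t0] := ltP t 0; first by rewrite e0_ge0 lexx.
by have [tT|tT] := leP t T; [rewrite e_ge0 ?e_nincr ?t0|rewrite lexx e0_ge0].
Qed.

Lemma profile_nincr s t : s <= t -> profile t <= profile s.
Proof.
move=> st; have /andP[t0 te] := profile_bounded t; have /andP[s0 _] := profile_bounded s.
have [s_lt0|s_ge0] := ltP s 0; first by rewrite [leRHS]/profile s_lt0.
have [tT|tT] := leP t T; last by rewrite profile_late.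
by rewrite !profileE ?e_nincr// ?s_ge0 ?(le_trans st)// (le_trans s_ge0).
Qed.

End Profile.

(** From 1 - x <= exp (- x). *)
Lemma slow_decay {R : realType} (m lam s : R) : 0 <= m -> 0 <= s ->
  0 <= lam -> `|expR (- (lam * s)) * m - m| <= m * (lam * s).
Proof.
move=> m0 s0 lam0; have ls0 : 0 <= lam * s by exact: mulr_ge0.
rewrite distrC ger0_norm; last first.
  by rewrite subr_ge0 ler_piMl// expR_le1 oppr_le0.
have := expR_ge1Dx (- (lam * s)) => le1.
by have : m * (1 - lam * s) <= m * expR (- (lam * s)); [exact: ler_wpM2l|lra].
Qed.

Theorem theorem1p3 (R : realType) (W : set (R3 R)) (eps T : R) (e : R -> R)
  (W_neq0 : W !=set0) (W_open : open W) (eps_gt0 : 0 < eps) (T_gt0 : 0 < T)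
  (e_ge0 : forall t, 0 <= t <= T -> 0 <= e t)
  (e_nincr : forall s t, 0 <= s -> s <= t -> t <= T -> e t <= e s) :
  exists (nu0 : R) (u : R -> R3 R -> R3 R),
    [/\ 0 < nu0,
        measurable_fun [set z : R * R3 R | 0 <= z.1] (fun z => u z.1 z.2),
        forall nu, 0 <= nu <= nu0 -> weak_NSI nu u,
        forall t, 0 <= t <= T -> supp (u t) `<=` W
      & forall t, 0 <= t <= T ->
          (`| L2norm (u t) - (e t)%:E | <= eps%:E)%E].
Proof.
have [a Wa] := W_neq0.
have /nbhs_ballP[r /= r0 ballW] : nbhs a W by exact: open_nbhs_nbhs.
(* Halving the radius puts the closed Euclidean ball inside the open ball. *)
pose rho := r / 2; have rho0 : 0 < rho by rewrite divr_gt0.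
pose N := Num.sqrt (swirl_mass a rho).
have N0 : 0 < N by rewrite sqrtr_gt0; exact: swirl_mass_gt0.
have e0 : 0 <= e 0 by apply: e_ge0; rewrite lexx ltW.
(* The error is at most e t * lam * T; the summand 1 covers the case e 0 = 0. *)
pose lam := eps / (T * (e 0 + 1)).
have lam0 : 0 < lam by rewrite divr_gt0// mulr_gt0// ltr_wpDl.
have rate0 : 0 < dissipation_rate rho by rewrite divr_gt0// exprn_gt0.
pose w t := profile T e t / N.
have w_nincr s t : s <= t -> w t <= w s.
  by move=> st; rewrite ler_pM2r ?invr_gt0// profile_nincr.
have w_bounded t : 0 <= w t <= e 0 / N.
  have /andP[p0 pe] := profile_bounded T_gt0 e_ge0 e_nincr t.
  by rewrite divr_ge0 ?(ltW N0)//= ler_pM2r ?invr_gt0.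
have w_late t : T < t -> w t = 0 by move=> Tt; rewrite /w profile_late// mul0r.
exists (lam / dissipation_rate rho), (decaying_swirl a rho lam w); split.
- exact: divr_gt0.
- exact: measurable_funS (measurable_decaying_swirl a rho0 (ltW lam0) w_nincr w_bounded).
- move=> nu /andP[nu0 nule].
  apply: (weak_NSI_decaying_swirl a rho0 (ltW lam0) T_gt0 w_nincr w_bounded w_late nu0).
  by rewrite -ler_pdivlMr.
- move=> t _ x /supp_decaying_swirl xrho; apply: ballW.
  rewrite -ball_normE /= distrC; apply: le_lt_trans (norm_le_enorm _) _.
  apply: (@le_lt_trans _ _ rho); last by rewrite ltr_pdivrMr// ltr_pMr// ltr1n.
  by rewrite -(ger0_norm (ltW rho0)) -sqrtr_sqr ler_wsqrtr.
- move=> t tT; have /andP[t0 t_le] := tT.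
  rewrite (L2norm_decaying_swirl a rho0 (ltW lam0) w_bounded) -/N.
  rewrite /amplitude max_r// /w profileE// -mulrA divfK ?gt_eqF// -EFinB lee_fin.
  have et : e t <= e 0 by exact: e_nincr.
  apply: le_trans (slow_decay (e_ge0 _ tT) t0 (ltW lam0)) _.
  apply: (@le_trans _ _ ((e 0 + 1) * (lam * T))).
    apply: ler_pM; [exact: e_ge0|by rewrite mulr_ge0// ltW|by rewrite (le_trans et)// lerDl|].
    by rewrite ler_pM2l.
  rewrite /lam le_eqVlt (_ : _ == _)//; apply/eqP; field.
  by rewrite !gt_eqF// ltr_wpDl.
Qed.
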